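(* Let $\Gamma$ be a finitely generated residually finite infinite group, $\{\Gamma_n\}_{n=1}^\infty$ a sequence of finite-index normal subgroups with $\bigcap_n\bigcup_{i\ge n}\Gamma_i=\{e\}$, and $f\in\mathbb{Z}\Gamma$ well-balanced. Let $\rho$ be a compatible metric on $X_f$. Then $\mathrm{Fix}_{\Gamma_n}(X_f)\to X_f$ in the Hausdorff distance as $n\to\infty$.
   Context: $f\in\mathbb{Z}\Gamma$ is well-balanced if $\sum_sf_s=0$, $f_s\le0$ for $s\ne e$, $f_s=f_{s^{-1}}$, and the support of $f$ generates $\Gamma$. $X_f=\{x\in(\mathbb{R}/\mathbb{Z})^\Gamma:\sum_sx_{ts}f_s=0\ \forall t\}$ with action $(sx)_t=x_{s^{-1}t}$; $\mathrm{Fix}_{\Gamma_n}(X_f)$ is the set of points fixed by all elements of $\Gamma_n$. Hausdorff distance between closed nonempty $Y,Z$: $\max(\max_{y\in Y}\min_{z\in Z}\rho(y,z),\max_{z\in Z}\min_{y\in Y}\rho(z,y))$. *)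

(* Defs.v *)
From Stdlib Require Import Reals Lra ZArith List ClassicalEpsilon.
Open Scope R_scope.

Record Group := {
  carrier :> Type;
  gmul : carrier -> carrier -> carrier;
  ginv : carrier -> carrier;
  gone : carrier;
  gmul_assoc : forall a b c, gmul a (gmul b c) = gmul (gmul a b) c;
  gmul_1l : forall a, gmul gone a = a;
  gmul_1r : forall a, gmul a gone = a;
  gmul_Vl : forall a, gmul (ginv a) a = gone;
  gmul_Vr : forall a, gmul a (ginv a) = gone }.

Arguments gmul {_}. Arguments ginv {_}. Arguments gone {_}.

Definition generates (G : Group) (S : G -> Prop) : Prop :=
  forall g : G, exists l : list G,
    Forall (fun s => S s \/ S (ginv s)) l /\ g = fold_right gmul gone l.

Definition finitely_generated (G : Group) : Prop :=
  exists l : list G, generates G (fun s => In s l).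

Definition infinite_group (G : Group) : Prop :=
  ~ exists l : list G, forall g : G, In g l.

Definition is_subgroup (G : Group) (H : G -> Prop) : Prop :=
  H gone /\ (forall a b, H a -> H b -> H (gmul a b)) /\ (forall a, H a -> H (ginv a)).

Definition is_normal_subgroup (G : Group) (H : G -> Prop) : Prop :=
  is_subgroup G H /\ forall g h, H h -> H (gmul (gmul g h) (ginv g)).

Definition finite_index (G : Group) (H : G -> Prop) : Prop :=
  exists reps : list G, forall g : G, exists r, In r reps /\ H (gmul (ginv r) g).

Definition finite_index_normal (G : Group) (H : G -> Prop) : Prop :=
  is_normal_subgroup G H /\ finite_index G H.

Definition residually_finite (G : Group) : Prop :=
  forall g : G, g <> gone -> exists H, finite_index_normal G H /\ ~ H g.

Record ZG (G : Group) := {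
  coef :> G -> Z;
  supp : list G;
  supp_nodup : NoDup supp;
  supp_spec : forall s, coef s <> 0%Z -> In s supp }.

Arguments coef {_}. Arguments supp {_}.

Definition well_balanced (G : Group) (f : ZG G) : Prop :=
  fold_right Z.add 0%Z (map (coef f) (supp f)) = 0%Z /\
  (forall s, s <> gone -> (coef f s <= 0)%Z) /\
  (forall s, coef f s = coef f (ginv s)) /\
  generates G (fun s => coef f s <> 0%Z).

(* A point of (R/Z)^Gamma is represented by its unique representative
   x : G -> R with values in [0,1). *)
Definition is_int (r : R) : Prop := exists k : Z, r = IZR k.

Definition torus_point (G : Group) (x : G -> R) : Prop :=
  forall t, 0 <= x t < 1.

Definition Xf (G : Group) (f : ZG G) (x : G -> R) : Prop :=
  torus_point G x /\
  forall t : G,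
    is_int (fold_right Rplus 0 (map (fun s => x (gmul t s) * IZR (coef f s)) (supp f))).

Definition shift (G : Group) (s : G) (x : G -> R) : G -> R :=
  fun t => x (gmul (ginv s) t).

Definition Fix (G : Group) (f : ZG G) (H : G -> Prop) (x : G -> R) : Prop :=
  Xf G f x /\ forall s, H s -> shift G s x = x.

(* the standard distance on R/Z between representatives in [0,1) *)
Definition tdist (a b : R) : R := Rmin (Rabs (a - b)) (1 - Rabs (a - b)).

Definition product_open (G : Group) (f : ZG G) (U : (G -> R) -> Prop) : Prop :=
  (forall x, U x -> Xf G f x) /\
  forall x, U x -> exists (F : list G) (eps : R), eps > 0 /\
     forall y, Xf G f y -> (forall t, In t F -> tdist (x t) (y t) < eps) -> U y.

Definition metric_on_Xf (G : Group) (f : ZG G) (rho : (G -> R) -> (G -> R) -> R) : Prop :=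
  forall x y z, Xf G f x -> Xf G f y -> Xf G f z ->
    0 <= rho x y /\ (rho x y = 0 <-> x = y) /\ rho x y = rho y x /\
    rho x z <= rho x y + rho y z.

Definition metric_open (G : Group) (f : ZG G) (rho : (G -> R) -> (G -> R) -> R)
  (U : (G -> R) -> Prop) : Prop :=
  (forall x, U x -> Xf G f x) /\
  forall x, U x -> exists delta, delta > 0 /\
     forall y, Xf G f y -> rho x y < delta -> U y.

Definition compatible_metric (G : Group) (f : ZG G) (rho : (G -> R) -> (G -> R) -> R)
  : Prop :=
  metric_on_Xf G f rho /\
  forall U, product_open G f U <-> metric_open G f rho U.

(* supremum / infimum of a set of reals (a junk value if it does not exist;
   for the closed nonempty subsets of the compact space X_f considered here,
   they exist and are the max / min of the paper's formula) *)
Definition Rsup (E : R -> Prop) : R := epsilon (inhabits 0) (is_lub E).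
Definition Rinf (E : R -> Prop) : R := - Rsup (fun r => E (- r)).

Definition hausdorff_dist {T : Type} (rho : T -> T -> R) (Y Z : T -> Prop) : R :=
  Rmax (Rsup (fun r => exists y, Y y /\ r = Rinf (fun d => exists z, Z z /\ d = rho y z)))
       (Rsup (fun r => exists z, Z z /\ r = Rinf (fun d => exists y, Y y /\ d = rho z y))).

(* Main.v *)
Require Import Defs.
From Stdlib Require Import Reals ZArith List.
From Stdlib Require Import Lra Lia Classical ClassicalEpsilon.
From Stdlib Require Import FunctionalExtensionality PropExtensionality Permutation Cantor.
Open Scope R_scope.

(** For [H] of finite index, the real lifts of [Fix_H(X_f)] are the [H]-periodic [y] with
    [lap y] integral.  Averaging a trigonometric polynomial with nonnegative coefficients,
    concentrated near the integer points, shows that if [Fix_H(X_f)] is not eps-dense in [X_f]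
    on a finite window, then some [h : Gamma -> Z] from a finite list independent of [H] is
    integral on [Fix_H(X_f)] but not on [X_f].

    Integrality on [Fix_H(X_f)] means that, modulo [H], [h] is the Laplacian of an [H]-periodic
    integer potential [g], whose gradient is bounded by the l1-norm of [h].  By the maximum
    principle [g] has bounded oscillation and the boundary of its top level set is close to the
    support of [h].  In the Cayley graph of a finite group a cut located near the identity has a
    side located near the identity (translate each side by one of its deep points and use that
    elements have finite order), so peeling off level sets shows that [g] is constant outside a
    ball of radius independent of [H].  When [H] meets a large ball only in the identity, [g] lifts to a finitely supported potential of [h] on [Gamma], and then
    [h] is integral on [X_f].  Compactness of [X_f] turns density on finite windows into
    Hausdorff convergence. *)

(** * Finite sums and linear systems *)

Definition rsum {A : Type} (l : list A) (u : A -> R) : R :=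
  fold_right Rplus 0 (map u l).

Lemma rsum_ext {A} (l : list A) u v :
  (forall a, In a l -> u a = v a) -> rsum l u = rsum l v.
Proof.
  unfold rsum; induction l as [|a l IH]; simpl; intros H; auto.
  rewrite H, IH; auto.
Qed.

Lemma rsum_plus {A} (l : list A) u v :
  rsum l (fun a => u a + v a) = rsum l u + rsum l v.
Proof. unfold rsum; induction l; simpl; lra. Qed.

Lemma rsum_scal {A} (l : list A) c u : rsum l (fun a => c * u a) = c * rsum l u.
Proof. unfold rsum; induction l; simpl; lra. Qed.

Lemma rsum_opp {A} (l : list A) u : rsum l (fun a => - u a) = - rsum l u.
Proof. unfold rsum; induction l; simpl; lra. Qed.

Lemma rsum_minus {A} (l : list A) u v :
  rsum l (fun a => u a - v a) = rsum l u - rsum l v.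
Proof. unfold rsum; induction l; simpl; lra. Qed.

Lemma rsum_zero {A} (l : list A) u : (forall a, In a l -> u a = 0) -> rsum l u = 0.
Proof.
  unfold rsum; induction l as [|a l IH]; simpl; intros H; auto.
  rewrite H, IH; auto; lra.
Qed.

Lemma rsum_le {A} (l : list A) u v :
  (forall a, In a l -> u a <= v a) -> rsum l u <= rsum l v.
Proof.
  unfold rsum; induction l as [|a l IH]; simpl; intros H; [lra|].
  assert (u a <= v a) by auto.
  assert (fold_right Rplus 0 (map u l) <= fold_right Rplus 0 (map v l)) by auto.
  lra.
Qed.

Lemma rsum_Rabs {A} (l : list A) u : Rabs (rsum l u) <= rsum l (fun a => Rabs (u a)).
Proof.
  unfold rsum; induction l as [|a l IH]; simpl; [rewrite Rabs_R0; lra|].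
  eapply Rle_trans; [apply Rabs_triang|lra].
Qed.

Lemma rsum_term_le {A} (l : list A) u a :
  (forall b, In b l -> 0 <= u b) -> In a l -> u a <= rsum l u.
Proof.
  unfold rsum; induction l as [|b l IH]; simpl; intros H [].
  - subst. assert (0 <= fold_right Rplus 0 (map u l)); [|lra].
    change (0 <= rsum l u). rewrite <- (rsum_zero l (fun _ => 0)) by auto.
    apply rsum_le; auto.
  - assert (0 <= u b) by auto. specialize (IH ltac:(auto) ltac:(auto)). lra.
Qed.

Lemma rsum_swap {A B} (l : list A) (m : list B) u :
  rsum l (fun a => rsum m (fun b => u a b)) = rsum m (fun b => rsum l (fun a => u a b)).
Proof.
  induction l as [|a l IH].
  - symmetry; apply rsum_zero; reflexivity.
  - change (rsum m (u a) + rsum l (fun a => rsum m (fun b => u a b)) =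
            rsum m (fun b => u a b + rsum l (fun a => u a b))).
    rewrite rsum_plus, IH; reflexivity.
Qed.

Lemma rsum_map {A B} (l : list A) (k : A -> B) u :
  rsum (map k l) u = rsum l (fun a => u (k a)).
Proof. unfold rsum; rewrite map_map; reflexivity. Qed.

Lemma rsum_perm {A} (l m : list A) u : Permutation l m -> rsum l u = rsum m u.
Proof. unfold rsum; induction 1; simpl; lra. Qed.

Definition eq_dec {A : Type} (a b : A) : {a = b} + {a <> b} :=
  excluded_middle_informative (a = b).

Lemma rsum_filter {A} (l : list A) (u : A -> R) :
  rsum l u = rsum (filter (fun a => if eq_dec (u a) 0 then false else true) l) u.
Proof.
  unfold rsum; induction l as [|a l IH]; simpl; auto.
  destruct (eq_dec (u a) 0) as [E|E]; simpl; lra.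
Qed.

(** Once the zero terms are dropped, both lists enumerate the support of [u] without repetition,
    hence are permutations of each other. *)
Lemma rsum_support {A} (l m : list A) u :
  NoDup l -> NoDup m -> (forall a, u a <> 0 -> In a l) -> (forall a, u a <> 0 -> In a m) ->
  rsum l u = rsum m u.
Proof.
  intros Hl Hm Ul Um.
  rewrite (rsum_filter l), (rsum_filter m).
  apply rsum_perm, NoDup_Permutation; try (apply NoDup_filter; assumption).
  intros a; rewrite !filter_In.
  destruct (eq_dec (u a) 0); split; intros [? ?]; split; auto; discriminate.
Qed.

Lemma rsum_is_int {A} (l : list A) u : (forall a, In a l -> is_int (u a)) -> is_int (rsum l u).
Proof.
  unfold rsum; induction l as [|a l IH]; simpl; intros H; [exists 0%Z; auto|].
  destruct (H a) as [k Hk]; auto. destruct IH as [j Hj]; auto.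
  exists (k + j)%Z; rewrite plus_IZR; lra.
Qed.

Lemma is_int_plus a b : is_int a -> is_int b -> is_int (a + b).
Proof. intros [j ->] [k ->]; exists (j + k)%Z; rewrite plus_IZR; auto. Qed.

Lemma is_int_opp a : is_int a -> is_int (- a).
Proof. intros [j ->]; exists (- j)%Z; rewrite opp_IZR; auto. Qed.

Lemma is_int_mult a b : is_int a -> is_int b -> is_int (a * b).
Proof. intros [j ->] [k ->]; exists (j * k)%Z; rewrite mult_IZR; auto. Qed.

Definition is_linear {X : Type} (a : (X -> R) -> R) : Prop :=
  forall u v c, a (fun x => u x + c * v x) = a u + c * a v.

(** Gaussian elimination, one unknown at a time: an equation involving the new unknown serves to
    eliminate it from the others. *)
Lemma linear_system_nontrivial {X : Type} (T : list X) :
  NoDup T -> forall L : list ((X -> R) -> R),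
  Forall is_linear L -> (length L < length T)%nat ->
  exists v : X -> R, (exists x, In x T /\ v x <> 0) /\ (forall x, ~ In x T -> v x = 0) /\
    Forall (fun a => a v = 0) L.
Proof.
  induction 1 as [|x T Hx HT IH]; intros L HL Hlen; [simpl in Hlen; lia|].
  set (d := fun y : X => if eq_dec y x then 1 else 0).
  assert (dx : d x = 1) by (unfold d; destruct (eq_dec x x); congruence).
  assert (dy : forall y, y <> x -> d y = 0)
    by (intros y; unfold d; destruct (eq_dec y x); congruence).
  destruct (classic (exists a, In a L /\ a d <> 0)) as [[a [Ha Had]]|Hno].
  - apply in_split in Ha as [L1 [L2 ->]].
    apply Forall_app in HL as [HL1 HL2]. inversion HL2 as [|? ? Hla HL2']; subst.
    (* The modified functionals vanish on [d], so adding a multiple of [d] to a common zero keeps it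
       one; the multiple is then chosen to make [a] vanish too. *)
    destruct (IH (map (fun b v => b v - b d / a d * a v) (L1 ++ L2)))
      as [v [[y [Hy Hvy]] [Hout Hv]]].
    + apply Forall_map. apply Forall_app. split; eapply Forall_impl; eauto;
        intros b Hb u v c; rewrite Hb, Hla; ring.
    + rewrite length_map, length_app in *; simpl in *; lia.
    + exists (fun z => v z + - (a v / a d) * d z).
      assert (Hav : a (fun z => v z + - (a v / a d) * d z) = 0)
        by (rewrite Hla; field; auto).
      split; [|split].
      * exists y; split; [simpl; auto|].
        rewrite dy by (intros ->; contradiction). lra.
      * intros z Hz; rewrite Hout, dy by (simpl in Hz; intuition). lra.
      * apply Forall_map in Hv. apply Forall_app in Hv as [Hv1 Hv2].
        assert (key : forall b, is_linear b -> b v - b d / a d * a v = 0 ->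
                  b (fun z => v z + - (a v / a d) * d z) = 0).
        { intros b Hb Hbv; rewrite Hb, <- Hbv; field; auto. }
        apply Forall_app; split; [|constructor; auto];
          rewrite Forall_forall in *; intros b Hb; apply key; auto.
  - exists d; split; [|split].
    + exists x; split; [simpl; auto|lra].
    + intros y Hy; apply dy; intros ->; apply Hy; simpl; auto.
    + apply Forall_forall; intros a Ha.
      apply NNPP; intros Hn; apply Hno; eauto.
Qed.

(** * Word balls and the Laplacian *)

Lemma ginv_mul (G : Group) (a b : G) : ginv (gmul a b) = gmul (ginv b) (ginv a).
Proof.
  rewrite <- (gmul_1r G (ginv (gmul a b))).
  rewrite <- (gmul_Vr G a).
  rewrite <- (gmul_1r G a) at 2. rewrite <- (gmul_Vr G b).
  rewrite <- !gmul_assoc. rewrite (gmul_assoc G a b).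
  rewrite (gmul_assoc G (ginv (gmul a b))), gmul_Vl, gmul_1l. reflexivity.
Qed.

Lemma ginv_inv (G : Group) (a : G) : ginv (ginv a) = a.
Proof.
  rewrite <- (gmul_1r G (ginv (ginv a))), <- (gmul_Vl G a), gmul_assoc, gmul_Vl.
  apply gmul_1l.
Qed.

Lemma ginv_1 (G : Group) : ginv (gone : G) = gone.
Proof. rewrite <- (gmul_1r G (ginv gone)). apply gmul_Vl. Qed.

Lemma gmulKV (G : Group) (a b : G) : gmul (gmul a b) (ginv b) = a.
Proof. rewrite <- gmul_assoc, gmul_Vr; apply gmul_1r. Qed.

Lemma gmulVK (G : Group) (a b : G) : gmul (gmul a (ginv b)) b = a.
Proof. rewrite <- gmul_assoc, gmul_Vl; apply gmul_1r. Qed.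

Lemma gmulKl (G : Group) (a b : G) : gmul (ginv a) (gmul a b) = b.
Proof. rewrite gmul_assoc, gmul_Vl; apply gmul_1l. Qed.

Lemma gmulVKl (G : Group) (a b : G) : gmul a (gmul (ginv a) b) = b.
Proof. rewrite gmul_assoc, gmul_Vr; apply gmul_1l. Qed.

Ltac gsimp := repeat (rewrite ?ginv_mul, ?ginv_inv, ?ginv_1, ?gmul_assoc, ?gmul_1l, ?gmul_1r,
  ?gmulKV, ?gmulVK, ?gmul_Vl, ?gmul_Vr).

Section WellBalanced.
Variable G : Group.
Variable f : ZG G.
Hypothesis Hf : well_balanced G f.

(** Balls of the Cayley graph of the support of [f], grown on the right because [lap] at [p] reads
    the values at [gmul p s]. *)
Fixpoint ball (k : nat) (g : G) : Prop :=
  match k with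
  | O => g = gone
  | S k => ball k g \/ exists b s, ball k b /\ coef f s <> 0%Z /\ g = gmul b s
  end.

Lemma coef_inv s : coef f (ginv s) = coef f s.
Proof. destruct Hf as (_ & _ & H & _); auto. Qed.

Lemma ball_mono j k g : (j <= k)%nat -> ball j g -> ball k g.
Proof. induction 1; simpl; auto. Qed.

Lemma ball_gen s : coef f s <> 0%Z -> ball 1 s.
Proof. intros Hs; right; exists gone, s; simpl; rewrite gmul_1l; auto. Qed.

Lemma ball_mul j k a b : ball j a -> ball k b -> ball (j + k) (gmul a b).
Proof.
  intros Ha; revert b; induction k as [|k IH]; simpl; intros b Hb.
  - subst; rewrite gmul_1r, Nat.add_0_r; auto.
  - rewrite Nat.add_succ_r. destruct Hb as [Hb|(c & s & Hc & Hs & ->)].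
    + left; auto.
    + right; exists (gmul a c), s; repeat split; auto using gmul_assoc.
Qed.

Lemma ball_step k a s : ball k a -> coef f s <> 0%Z -> ball (S k) (gmul a s).
Proof. right; eauto. Qed.

Lemma ball_inv k a : ball k a -> ball k (ginv a).
Proof.
  revert a; induction k as [|k IH]; simpl; intros a Ha.
  - subst; apply ginv_1.
  - destruct Ha as [Ha|(c & s & Hc & Hs & ->)]; [left; auto|].
    rewrite ginv_mul. apply (ball_mul 1 k); auto.
    apply ball_gen; rewrite coef_inv; auto.
Qed.

Lemma ball_exhaust g : exists k, ball k g.
Proof.
  destruct Hf as (_ & _ & _ & Hgen). destruct (Hgen g) as [l [Hl ->]].
  induction Hl as [|s l Hs Hl [k IH]]; simpl; [exists 0%nat; reflexivity|].
  exists (1 + k)%nat; apply (ball_mul 1 k); auto. apply ball_gen.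
  destruct Hs; [|rewrite <- coef_inv]; auto.
Qed.

Lemma list_in_ball (F : list G) : exists k, forall t, In t F -> ball k t.
Proof.
  induction F as [|t F [k IH]]; [exists 0%nat; simpl; tauto|].
  destruct (ball_exhaust t) as [j Hj]. exists (j + k)%nat.
  intros u [<-|Hu]; [apply (ball_mono j)|apply (ball_mono k)]; auto; lia.
Qed.

Lemma gen_ind (P : G -> Prop) :
  P gone -> (forall p s, P p -> coef f s <> 0%Z -> P (gmul p s)) -> forall g, P g.
Proof.
  intros H1 HS g. destruct (ball_exhaust g) as [k Hk]; revert g Hk.
  induction k as [|k IH]; simpl; intros g Hg; [subst; auto|].
  destruct Hg as [|(b & s & Hb & Hs & ->)]; auto.
Qed.

Lemma ball_finite k : exists l : list G, forall g, ball k g -> In g l.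
Proof.
  induction k as [|k [l IH]]; simpl.
  - exists (gone :: nil); simpl; auto.
  - exists (l ++ flat_map (fun b => map (gmul b) (supp f)) l).
    intros g [Hg|(b & s & Hb & Hs & ->)]; apply in_or_app; auto.
    right; apply in_flat_map; exists b; split; auto.
    apply in_map, supp_spec; auto.
Qed.

(** Convertible with the sum in [Xf]. For well-balanced [f] it is a weighted graph Laplacian, with
    the sign that makes it nonnegative at maxima. *)
Definition lap (y : G -> R) (p : G) : R :=
  rsum (supp f) (fun s => y (gmul p s) * IZR (coef f s)).

Lemma coef_sum : rsum (supp f) (fun s => IZR (coef f s)) = 0.
Proof.
  destruct Hf as (H & _). unfold rsum.
  transitivity (IZR (fold_right Z.add 0%Z (map (coef f) (supp f)))); [|rewrite H; auto].
  generalize (supp f); intros l; induction l; simpl; auto.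
  rewrite plus_IZR, IHl; auto.
Qed.

Lemma lap_ext y z p : (forall q, y q = z q) -> lap y p = lap z p.
Proof. intros H; apply rsum_ext; intros; rewrite H; auto. Qed.

Lemma lap_plus y z p : lap (fun q => y q + z q) p = lap y p + lap z p.
Proof. unfold lap; rewrite <- rsum_plus; apply rsum_ext; intros; ring. Qed.

Lemma lap_scal c y p : lap (fun q => c * y q) p = c * lap y p.
Proof. unfold lap; rewrite <- rsum_scal; apply rsum_ext; intros; ring. Qed.

Lemma lap_opp y p : lap (fun q => - y q) p = - lap y p.
Proof. unfold lap; rewrite <- rsum_opp; apply rsum_ext; intros; ring. Qed.

Lemma lap_minus y z p : lap (fun q => y q - z q) p = lap y p - lap z p.
Proof. unfold lap; rewrite <- rsum_minus; apply rsum_ext; intros; ring. Qed.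

Lemma lap_const c p : lap (fun _ => c) p = 0.
Proof. unfold lap; rewrite rsum_scal, coef_sum; ring. Qed.

Lemma lap_translate y a p : lap (fun q => y (gmul a q)) p = lap y (gmul a p).
Proof. apply rsum_ext; intros; rewrite gmul_assoc; auto. Qed.

Lemma lap_int_valued y p : (forall q, is_int (y q)) -> is_int (lap y p).
Proof.
  intros H; apply rsum_is_int; intros; apply is_int_mult; auto. eexists; eauto.
Qed.

(** As the coefficients sum to zero, [lap y p] is the sum of [(y p - y (gmul p s)) * (- coef f s)].
    At a maximum all terms are nonnegative, and integrality gives [- coef f s >= 1] on the support
    off the identity, so the sum dominates each difference. *)
Lemma lap_at_max y p s :
  (forall q, y q <= y p) -> coef f s <> 0%Z -> y p - y (gmul p s) <= lap y p.
Proof.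
  intros Hmax Hs.
  assert (E : lap y p = rsum (supp f) (fun s => (y p - y (gmul p s)) * IZR (- coef f s))).
  { transitivity (lap y p - lap (fun _ => y p) p); [rewrite lap_const; ring|].
    unfold lap; rewrite <- rsum_minus. apply rsum_ext; intros; rewrite opp_IZR; ring. }
  assert (pos : forall s, 0 <= (y p - y (gmul p s)) * IZR (- coef f s)).
  { intros t. destruct (eq_dec t gone) as [->|Ht]; [rewrite gmul_1r; lra|].
    apply Rmult_le_pos; [specialize (Hmax (gmul p t)); lra|].
    apply IZR_le. destruct Hf as (_ & H & _). specialize (H t Ht). lia. }
  rewrite E.
  eapply Rle_trans;
    [|apply (rsum_term_le _ (fun s => (y p - y (gmul p s)) * IZR (- coef f s)) s);
      [intros; apply pos|apply supp_spec; auto]].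
  destruct (eq_dec s gone) as [->|Hs1]; [rewrite gmul_1r; lra|].
  assert (1 <= IZR (- coef f s)).
  { apply IZR_le. destruct Hf as (_ & H & _). specialize (H s Hs1). lia. }
  specialize (Hmax (gmul p s)). nra.
Qed.

(** The source of the self-adjointness of [lap]. The list [supp f] may contain zeros of [f] and need
    not be closed under inversion, so the two sums are compared through their supports. *)
Lemma rsum_coef_inv (u : G -> R) :
  rsum (supp f) (fun s => u s * IZR (coef f s)) =
  rsum (supp f) (fun s => u (ginv s) * IZR (coef f s)).
Proof.
  transitivity (rsum (map ginv (supp f)) (fun s => u s * IZR (coef f s))).
  - apply rsum_support.
    + apply supp_nodup.
    + apply FinFun.Injective_map_NoDup; [|apply supp_nodup].
      intros a b E; rewrite <- (ginv_inv _ a), E; apply ginv_inv.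
    + intros s Hs; apply supp_spec; intros E; apply Hs; rewrite E; ring.
    + intros s Hs; apply in_map_iff; exists (ginv s); split; [apply ginv_inv|].
      apply supp_spec; rewrite coef_inv; intros E; apply Hs; rewrite E; ring.
  - rewrite rsum_map; apply rsum_ext; intros; rewrite coef_inv; auto.
Qed.

Definition invariant {A : Type} (H : G -> Prop) (y : G -> A) : Prop :=
  forall g h, H h -> y (gmul g h) = y g.

(** * Finite quotients: maximum principle and Green function *)

Section FiniteQuotient.
Variable H : G -> Prop.
Hypothesis HH : finite_index_normal G H.

Lemma subgroup_one : H gone.
Proof. apply HH. Qed.

Lemma subgroup_mul a b : H a -> H b -> H (gmul a b).
Proof. apply HH. Qed.

Lemma subgroup_inv a : H a -> H (ginv a).
Proof. apply HH. Qed.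

Lemma subgroup_conj g h : H h -> H (gmul (gmul g h) (ginv g)).
Proof. apply HH. Qed.

Lemma subgroup_comm a b : H (gmul a b) -> H (gmul b a).
Proof.
  intros K. replace (gmul b a) with (gmul (gmul b (gmul a b)) (ginv b)) by (gsimp; auto).
  apply subgroup_conj; auto.
Qed.

Lemma subgroup_of_mul_r a h : H h -> H (gmul a h) -> H a.
Proof.
  intros Hh K. replace a with (gmul (gmul a h) (ginv h)) by (gsimp; auto).
  apply subgroup_mul, subgroup_inv; auto.
Qed.

Lemma invariant_l {A} (y : G -> A) h g : invariant H y -> H h -> y (gmul h g) = y g.
Proof.
  intros Hy Hh. replace (gmul h g) with (gmul g (gmul (gmul (ginv g) h) (ginv (ginv g))))
    by (gsimp; auto).
  apply Hy, subgroup_conj; auto.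
Qed.

Lemma invariant_eq {A} (y : G -> A) a b : invariant H y -> H (gmul (ginv a) b) -> y b = y a.
Proof.
  intros Hy K. rewrite <- (gmulVKl G a b). apply Hy; auto.
Qed.

Lemma lap_invariant y : invariant H y -> invariant H (lap y).
Proof.
  intros Hy g h Hh. apply rsum_ext; intros s _.
  replace (gmul (gmul g h) s) with (gmul (gmul (gmul g h) (ginv g)) (gmul g s))
    by (gsimp; auto).
  rewrite (invariant_l y); auto using subgroup_conj.
Qed.

Lemma invariant_has_max (y : G -> R) :
  invariant H y -> exists p, forall q, y q <= y p.
Proof.
  intros Hy. destruct HH as [_ [reps Hreps]].
  assert (K : forall l : list G, l <> nil -> exists p, forall q, In q l -> y q <= y p).
  { induction l as [|a l IH]; [congruence|intros _].
    destruct l as [|b l].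
    - exists a; intros q [<-|[]]; lra.
    - destruct IH as [p Hp]; [congruence|].
      destruct (Rle_dec (y p) (y a)).
      + exists a; intros q [<-|Hq]; [lra|]. specialize (Hp q Hq); lra.
      + exists p; intros q [<-|Hq]; [lra|auto]. }
  destruct (K reps) as [p Hp].
  - intros ->. destruct (Hreps gone) as [r [[] _]].
  - exists p; intros q. destruct (Hreps q) as [r [Hr Hq]].
    rewrite (invariant_eq y r q); auto.
Qed.

(** If no maximum point has positive Laplacian, [lap_at_max] makes every neighbour of a maximum
    point a maximum point, and generation spreads this to the whole group. *)
Lemma max_principle (y : G -> R) :
  invariant H y ->
  exists p, (forall q, y q <= y p) /\ (0 < lap y p \/ forall q, y q = y p).
Proof.
  intros Hy. destruct (invariant_has_max y Hy) as [p0 Hp0].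
  destruct (classic (exists p, y p = y p0 /\ 0 < lap y p)) as [[p [E Hp]]|Hno].
  - exists p; rewrite E; auto.
  - exists p0; split; auto; right.
    assert (K : forall g, y (gmul p0 g) = y p0).
    { apply gen_ind.
      - rewrite gmul_1r; auto.
      - intros p s E Hs. apply Rle_antisym; auto.
        assert (lap y (gmul p0 p) <= 0).
        { apply Rnot_lt_le; intros L; apply Hno; eauto. }
        assert (L := lap_at_max y (gmul p0 p) s).
        rewrite E, <- gmul_assoc in L. specialize (L Hp0 Hs). lra. }
    intros q; rewrite <- (K (gmul (ginv p0) q)), gmulVKl; auto.
Qed.

Lemma min_principle (y : G -> R) :
  invariant H y ->
  exists p, (forall q, y p <= y q) /\ (lap y p < 0 \/ forall q, y q = y p).
Proof.
  intros Hy. destruct (max_principle (fun q => - y q)) as [p [Hp D]].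
  - intros g h Hh; rewrite Hy; auto.
  - exists p; split; [intros q; specialize (Hp q); lra|].
    rewrite lap_opp in D. destruct D as [D|D]; [left; lra|].
    right; intros q; specialize (D q); lra.
Qed.

Lemma harmonic_const y p q : invariant H y -> (forall g, lap y g = 0) -> y p = y q.
Proof.
  intros Hy L. destruct (max_principle y Hy) as [m [_ [C|C]]].
  - rewrite L in C; lra.
  - rewrite (C p), (C q); auto.
Qed.

Definition ind (g : G) : R := if excluded_middle_informative (H g) then 1 else 0.

Lemma ind_in g : H g -> ind g = 1.
Proof. unfold ind; destruct (excluded_middle_informative (H g)); tauto. Qed.

Lemma ind_out g : ~ H g -> ind g = 0.
Proof. unfold ind; destruct (excluded_middle_informative (H g)); tauto. Qed.

Lemma ind_iff a b : (H a <-> H b) -> ind a = ind b.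
Proof.
  intros E. destruct (classic (H a)).
  - rewrite !ind_in; tauto.
  - rewrite !ind_out; tauto.
Qed.

Lemma ind_invariant : invariant H ind.
Proof.
  intros g h Hh; apply ind_iff; split; intros K; [exact (subgroup_of_mul_r _ _ Hh K)|apply subgroup_mul; auto].
Qed.

Definition coset_rep (g : G) : G := epsilon (inhabits gone) (fun r => H (gmul (ginv r) g)).

Lemma coset_rep_spec g : H (gmul (ginv (coset_rep g)) g).
Proof.
  unfold coset_rep. apply (epsilon_spec (inhabits gone) (fun r => H (gmul (ginv r) g))).
  exists g; rewrite gmul_Vl; apply subgroup_one.
Qed.

(** Elements of one coset give equal predicates by extensionality, so [epsilon] makes the same
    choice for all of them. *)
Lemma coset_rep_invariant : invariant H coset_rep.
Proof.
  intros g h Hh; unfold coset_rep; f_equal.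
  apply functional_extensionality; intros r; apply propositional_extensionality.
  rewrite gmul_assoc; split; intros K; [exact (subgroup_of_mul_r _ _ Hh K)|apply subgroup_mul; auto].
Qed.

(* The operator [y |-> lap y + y(e)] is injective on the finite-dimensional space of
   invariant functions, hence hits a multiple of [ind]. *)
Lemma green_function :
  exists (y : G -> R) (c : R), invariant H y /\ forall p, lap y p = ind p - c.
Proof.
  pose proof (proj2 HH) as [reps Hreps].
  set (T := nodup eq_dec (map coset_rep reps)).
  assert (HT : forall g, In (coset_rep g) T).
  { intros g; apply nodup_In. destruct (Hreps g) as [r [Hr Hg]].
    rewrite (invariant_eq coset_rep r g); auto using coset_rep_invariant.
    apply in_map; auto. }
  (* The unknowns are one value per coset representative and, at [None], the multiple of [ind]: one
     more unknown than equations. *)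
  set (row := fun (g : G) (v : option G -> R) =>
    lap (fun q => v (Some (coset_rep q))) g + v (Some (coset_rep gone)) - ind g * v None).
  destruct (linear_system_nontrivial (None :: map Some T)) with (L := map row T)
    as [v [[x [Hx Hvx]] [Hout Hv]]].
  - constructor.
    + intros K; apply in_map_iff in K as [? [? _]]; discriminate.
    + apply FinFun.Injective_map_NoDup; [intros a b E; congruence|apply NoDup_nodup].
  - apply Forall_map, Forall_forall; intros g _ u w c; unfold row.
    rewrite lap_plus, lap_scal; ring.
  - simpl; rewrite !length_map; lia.
  - set (y := fun q => v (Some (coset_rep q))).
    assert (Hy : invariant H y) by (intros g h Hh; unfold y; rewrite coset_rep_invariant; auto).
    assert (eqn : forall g, lap y g + y gone = ind g * v None).
    { intros g. rewrite Forall_map, Forall_forall in Hv.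
      specialize (Hv _ (HT g)). unfold row in Hv. fold y in Hv. fold (y gone) in Hv.
      rewrite (invariant_eq (lap y) (coset_rep g) g), (invariant_eq ind (coset_rep g) g);
        auto using coset_rep_spec, ind_invariant, lap_invariant.
      lra. }
    (* If the multiple of [ind] is zero, [lap y] is the constant [- y gone]. Its signs at a maximum
       and at a minimum force it to be zero, so [y] is constant and vanishes, against the
       nontriviality of [v]. *)
    destruct (Req_dec (v None) 0) as [E|E].
    + exfalso. rewrite E in eqn.
      assert (Y0 : y gone = 0).
      { destruct (max_principle y Hy) as [p [Hp D]].
        destruct (min_principle y Hy) as [q [Hq D']].
        assert (0 <= lap y p).
        { destruct D as [D|D]; [lra|]. rewrite (lap_ext y (fun _ => y p)); auto.
          rewrite lap_const; lra. }
        assert (lap y q <= 0).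
        { destruct D' as [D'|D']; [lra|]. rewrite (lap_ext y (fun _ => y q)); auto.
          rewrite lap_const; lra. }
        assert (e1 := eqn p); assert (e2 := eqn q); lra. }
      assert (Yz : forall q, y q = 0).
      { intros q; rewrite <- Y0; apply harmonic_const; auto.
        intros g; specialize (eqn g); lra. }
      destruct x as [r|]; [|contradiction].
      destruct Hx as [Hx|Hx]; [discriminate|].
      apply in_map_iff in Hx as [r' [Er Hr]]. injection Er as ->.
      unfold T in Hr. apply nodup_In, in_map_iff in Hr as [a [<- _]].
      apply Hvx, (Yz a).
    + exists (fun q => / v None * y q), (/ v None * y gone). split.
      * intros g h Hh; rewrite Hy; auto.
      * intros p; rewrite lap_scal. specialize (eqn p).
        replace (lap y p) with (ind p * v None - y gone) by lra. field; auto.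
Qed.

(** * Annihilating frequencies and their integer potentials *)

Definition pairing (F : list G) (h : G -> Z) (y : G -> R) : R :=
  rsum F (fun t => IZR (h t) * y t).

Lemma pairing_minus F h y z : pairing F h (fun t => y t - z t) = pairing F h y - pairing F h z.
Proof. unfold pairing; rewrite <- rsum_minus; apply rsum_ext; intros; ring. Qed.

Lemma pairing_const F h c : pairing F h (fun _ => c) = c * pairing F h (fun _ => 1).
Proof. unfold pairing; rewrite <- rsum_scal; apply rsum_ext; intros; ring. Qed.

(* The real lifts of the points of [Fix G f H]. *)
Definition periodic_solution (y : G -> R) : Prop :=
  invariant H y /\ forall p, is_int (lap y p).

Lemma is_int_ind p : is_int (ind p).
Proof.
  unfold ind; destruct (excluded_middle_informative (H p)); [exists 1%Z|exists 0%Z]; auto.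
Qed.

(** Constants are periodic solutions; if the sum [S] of [h] over [F] were nonzero, the constant
    [1 / (2 S)] would have pairing [1/2]. *)
Lemma annihilator_sum_zero F h :
  (forall y, periodic_solution y -> is_int (pairing F h y)) -> pairing F h (fun _ => 1) = 0.
Proof.
  intros A. apply NNPP; intros N.
  set (c := / (2 * pairing F h (fun _ => 1))).
  destruct (A (fun _ => c)) as [k Hk].
  - split; [intros ? ? ?; auto|]. intros p; exists 0%Z; apply lap_const.
  - rewrite pairing_const in Hk. unfold c in Hk.
    assert (K : 1 = 2 * IZR k) by (rewrite <- Hk; field; auto).
    rewrite <- mult_IZR in K. apply eq_IZR in K. lia.
Qed.

(* [u] is the unit current from [gmul p s] to its neighbour [p]: its maximum and minimum are
   at the source and at the sink. *)
Lemma unit_current_osc u p s :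
  invariant H u -> coef f s <> 0%Z ->
  (forall q, lap u q = ind (gmul (ginv (gmul p s)) q) - ind (gmul (ginv p) q)) ->
  forall t, 0 <= u t - u p <= 1.
Proof.
  intros Hu Hs Hlap t.
  assert (bnd : forall q, 0 <= ind q <= 1).
  { intros q; unfold ind; destruct (excluded_middle_informative (H q)); lra. }
  destruct (max_principle u Hu) as [m [Hm D]].
  destruct (min_principle u Hu) as [n [Hn D']].
  destruct D as [D|D]; [|rewrite (D t), (D p); lra].
  destruct D' as [D'|D']; [|rewrite (D' t), (D' p); lra].
  assert (Em : u m = u (gmul p s)).
  { apply invariant_eq; auto. apply NNPP; intros N. rewrite Hlap, (ind_out _ N) in D.
    specialize (bnd (gmul (ginv p) m)). lra. }
  assert (En : u n = u p).
  { apply invariant_eq; auto. apply NNPP; intros N.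
    rewrite Hlap, (ind_out (gmul (ginv p) n) N) in D'.
    specialize (bnd (gmul (ginv (gmul p s)) n)). lra. }
  (* The Laplacian at the source is at most 1, so [lap_at_max] bounds the drop from source to
     sink. *)
  assert (L : u (gmul p s) - u (gmul (gmul p s) (ginv s)) <= lap u (gmul p s)).
  { apply lap_at_max; [rewrite <- Em; auto|rewrite coef_inv; auto]. }
  rewrite gmulKV, Hlap in L.
  assert (b1 := bnd (gmul (ginv (gmul p s)) (gmul p s))).
  assert (b2 := bnd (gmul (ginv p) (gmul p s))).
  specialize (Hm t). specialize (Hn t). lra.
Qed.

(** With [y0] the Green function, [g p] pairs [h] with the translate of [y0] by [p] minus [y0]
    itself. That difference has a difference of two indicators as Laplacian, hence is a periodic
    solution, and so [g] is integer valued. *)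
Lemma annihilator_is_principal F h :
  (forall y, periodic_solution y -> is_int (pairing F h y)) ->
  exists g : G -> Z, invariant H g /\
    (forall p, lap (fun q => IZR (g q)) p = pairing F h (fun t => ind (gmul (ginv p) t))) /\
    (forall p s, coef f s <> 0%Z ->
       Rabs (IZR (g (gmul p s)) - IZR (g p)) <= rsum F (fun t => Rabs (IZR (h t)))).
Proof.
  intros A. assert (S0 := annihilator_sum_zero F h A).
  destruct green_function as (y0 & c & Hy0 & Ly0).
  assert (gex : forall p, exists k : Z,
            pairing F h (fun t => y0 (gmul (ginv p) t)) - pairing F h y0 = IZR k).
  { intros p. rewrite <- pairing_minus. apply A. split.
    - intros g h0 Hh; rewrite gmul_assoc, !(Hy0 _ _ Hh); auto.
    - intros q. rewrite lap_minus, lap_translate, !Ly0.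
      replace (ind (gmul (ginv p) q) - c - (ind q - c))
        with (ind (gmul (ginv p) q) + - ind q) by ring.
      apply is_int_plus; [|apply is_int_opp]; apply is_int_ind. }
  set (g := fun p => epsilon (inhabits 0%Z) (fun k =>
     pairing F h (fun t => y0 (gmul (ginv p) t)) - pairing F h y0 = IZR k)).
  assert (gspec : forall p,
     IZR (g p) = pairing F h (fun t => y0 (gmul (ginv p) t)) - pairing F h y0).
  { intros p; symmetry. exact (epsilon_spec (inhabits 0%Z) _ (gex p)). }
  exists g; split; [|split].
  - intros p k Hk. apply eq_IZR. rewrite !gspec. f_equal.
    apply rsum_ext; intros t _. f_equal. rewrite ginv_mul, <- gmul_assoc.
    apply invariant_l; auto using subgroup_inv.
  - intros p.
    (* [z] is the Laplacian of the translated Green function in the translation parameter [p], and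
       [w] is the indicator of the coset of [p]. Both have the same Laplacian in [t], so they differ
       by a constant, whose pairing with [h] is zero. *)
    set (z := fun t => rsum (supp f) (fun s => y0 (gmul (ginv (gmul p s)) t) * IZR (coef f s))).
    set (w := fun t => ind (gmul (ginv p) t)).
    assert (E1 : lap (fun q => IZR (g q)) p = pairing F h z).
    { transitivity (lap (fun q => pairing F h (fun t => y0 (gmul (ginv q) t))) p -
                    lap (fun _ => pairing F h y0) p).
      - rewrite <- lap_minus; apply lap_ext; auto.
      - rewrite lap_const, Rminus_0_r. unfold lap, pairing, z.
        transitivity (rsum (supp f) (fun s => rsum F (fun t =>
          IZR (h t) * y0 (gmul (ginv (gmul p s)) t) * IZR (coef f s)))).
        + apply rsum_ext; intros s _. rewrite Rmult_comm, <- rsum_scal.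
          apply rsum_ext; intros; ring.
        + rewrite rsum_swap. apply rsum_ext; intros t _. rewrite <- rsum_scal.
          apply rsum_ext; intros; ring. }
    assert (Lz : forall q, lap z q = lap w q).
    { intros q.
      transitivity (rsum (supp f) (fun s =>
         lap (fun t => y0 (gmul (ginv (gmul p s)) t)) q * IZR (coef f s))).
      - unfold lap, z.
        transitivity (rsum (supp f) (fun s' => rsum (supp f) (fun s =>
          y0 (gmul (ginv (gmul p s)) (gmul q s')) * IZR (coef f s') * IZR (coef f s)))).
        + apply rsum_ext; intros s' _. rewrite Rmult_comm, <- rsum_scal.
          apply rsum_ext; intros; ring.
        + rewrite rsum_swap. apply rsum_ext; intros s _. symmetry.
          rewrite Rmult_comm, <- rsum_scal. apply rsum_ext; intros; ring.
      - transitivity (rsum (supp f) (fun s =>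
          ind (gmul (ginv s) (gmul (ginv p) q)) * IZR (coef f s))).
        + transitivity (rsum (supp f) (fun s =>
            ind (gmul (ginv s) (gmul (ginv p) q)) * IZR (coef f s) - c * IZR (coef f s))).
          * apply rsum_ext; intros s _. rewrite lap_translate, Ly0. gsimp; ring.
          * rewrite rsum_minus, rsum_scal, coef_sum; ring.
        + rewrite (rsum_coef_inv (fun s => ind (gmul (ginv s) (gmul (ginv p) q)))).
          apply rsum_ext; intros s _. f_equal. unfold w. rewrite ginv_inv.
          apply ind_iff. rewrite (gmul_assoc G (ginv p) q s).
          split; apply subgroup_comm. }
    assert (Hzw : invariant H (fun q => z q - w q)).
    { intros a b Hb. f_equal.
      - apply rsum_ext; intros; rewrite gmul_assoc, (Hy0 _ _ Hb); auto.
      - unfold w. rewrite gmul_assoc; apply ind_invariant; auto. }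
    rewrite E1. fold w. apply Rminus_diag_uniq. rewrite <- pairing_minus.
    transitivity (pairing F h (fun _ => z gone - w gone)).
    + apply rsum_ext; intros t _. f_equal.
      apply (harmonic_const (fun q => z q - w q)); auto.
      intros q; rewrite lap_minus, Lz; ring.
    + rewrite pairing_const, S0; ring.
  - intros p s Hs.
    (* The unit current along the edge. As [h] has sum zero, [u p] may be subtracted from [u], so
       its oscillation bounds the gradient of [g]. *)
    set (u := fun t => y0 (gmul (ginv (gmul p s)) t) - y0 (gmul (ginv p) t)).
    assert (osc : forall t, 0 <= u t - u p <= 1).
    { apply (unit_current_osc u p s); auto.
      - intros a b Hb; unfold u; rewrite !gmul_assoc, !(Hy0 _ _ Hb); auto.
      - intros q. unfold u. rewrite lap_minus, !lap_translate, !Ly0. ring. }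
    replace (IZR (g (gmul p s)) - IZR (g p)) with (pairing F h (fun t => u t - u p)).
    + eapply Rle_trans; [apply rsum_Rabs|]. apply rsum_le; intros t _.
      rewrite Rabs_mult, (Rabs_right (u t - u p)) by (specialize (osc t); lra).
      assert (a := Rabs_pos (IZR (h t))). specialize (osc t). nra.
    + rewrite pairing_minus, pairing_const, S0, !gspec. unfold u. rewrite pairing_minus. ring.
Qed.

(** * Small cuts in finite quotients *)

Fixpoint gpow (k : nat) (a : G) : G :=
  match k with O => gone | S k => gmul a (gpow k a) end.

Lemma gpow_add i j a : gpow (i + j) a = gmul (gpow i a) (gpow j a).
Proof. induction i; simpl; [rewrite gmul_1l|rewrite IHi, gmul_assoc]; auto. Qed.

(** Pigeonhole: take one more power of [a] than there are coset representatives. *)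
Lemma finite_order a : exists k, H (gpow (S k) a).
Proof.
  apply NNPP; intros N.
  pose proof (proj2 HH) as [reps Hreps].
  assert (Hlt : forall i j, (i < j)%nat -> coset_rep (gpow i a) <> coset_rep (gpow j a)).
  { intros i j Hij E. apply N. exists (j - i - 1)%nat.
    assert (Hi := coset_rep_spec (gpow i a)). assert (Hj := coset_rep_spec (gpow j a)).
    rewrite E in Hi. apply subgroup_inv in Hi. assert (K := subgroup_mul _ _ Hi Hj).
    replace j with (i + S (j - i - 1))%nat in K at 3 by lia.
    rewrite gpow_add in K. revert K. gsimp. auto. }
  assert (L : (length (map (fun k => coset_rep (gpow k a)) (seq 0 (S (length reps)))) <=
               length (map coset_rep reps))%nat).
  { apply NoDup_incl_length.
    - apply FinFun.Injective_map_NoDup_in; [|apply seq_NoDup].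
      intros i j _ _ E. destruct (Nat.lt_trichotomy i j) as [L|[L|L]]; auto;
        [|symmetry in E]; apply Hlt in E; tauto.
    - intros r Hr. apply in_map_iff in Hr as [k [<- _]].
      destruct (Hreps (gpow k a)) as [r [Hr Hg]].
      rewrite (invariant_eq coset_rep r); auto using coset_rep_invariant.
      apply in_map; auto. }
  rewrite !length_map, length_seq in L. lia.
Qed.

(** Translation by the inverse of [a] maps [P] into its subset [Q]. Some positive power of [a] lies
    in [H], so iteration brings each point of [P] back to its own coset, now inside [Q]. *)
Lemma recurrence (P Q : G -> Prop) a :
  invariant H Q -> (forall p, P p -> Q (gmul (ginv a) p)) -> (forall p, Q p -> P p) ->
  forall p, P p -> Q p.
Proof.
  intros HQ PQ QP.
  assert (K : forall k p, P p -> Q (gmul (ginv (gpow (S k) a)) p)).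
  { induction k as [|k IH]; intros p Hp.
    - simpl; rewrite gmul_1r; auto.
    - change (gpow (S (S k)) a) with (gmul a (gpow (S k) a)).
      rewrite ginv_mul, <- gmul_assoc. auto. }
  intros p Hp. destruct (finite_order a) as [k Hk].
  specialize (K k p Hp). rewrite (invariant_l Q) in K; auto using subgroup_inv.
Qed.

Definition near (R : nat) (p : G) : Prop :=
  exists b h, ball R b /\ H h /\ p = gmul b h.

Lemma near_mono j k p : (j <= k)%nat -> near j p -> near k p.
Proof. intros L (b & h & Hb & Hh & ->). exists b, h; eauto using ball_mono. Qed.

Lemma ball_near k p : ball k p -> near k p.
Proof. exists p, gone; rewrite gmul_1r; auto using subgroup_one. Qed.

Lemma near_mul j k p b : near j p -> ball k b -> near (j + k) (gmul p b).
Proof.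
  intros (a & h & Ha & Hh & ->) Hb.
  exists (gmul a b), (gmul (gmul (ginv b) h) (ginv (ginv b))). repeat split.
  - apply ball_mul; auto.
  - apply subgroup_conj; auto.
  - gsimp; auto.
Qed.

Lemma near_step k p s : near k p -> coef f s <> 0%Z -> near (S k) (gmul p s).
Proof.
  intros Hp Hs. rewrite <- Nat.add_1_r. apply near_mul; auto using ball_gen.
Qed.

Definition cut_near (R : nat) (A : G -> Prop) : Prop :=
  forall p s, coef f s <> 0%Z -> ~ (A p <-> A (gmul p s)) -> near R p /\ near R (gmul p s).

(* If [a] lies deep inside [A], the set [~ A \/ near R] is connected and avoids the boundary
   of the translate of [A] by [a], so it lies inside that translate or off it; the second
   case is excluded by [recurrence]. *)
Lemma deep_translate_covers R A a p0 :
  invariant H A -> cut_near R A -> A a -> ~ near (R + R) a -> A p0 -> near R p0 ->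
  forall p, ~ A p \/ near R p -> A (gmul (ginv a) p).
Proof.
  intros HA cut Aa Ha Ap0 Hp0.
  (* If [b] and [gmul a b] were both near, [a] would be a near point times the inverse of another,
     hence within [R + R]. *)
  assert (far : forall b, near R b -> ~ near R (gmul a b)).
  { intros b (c & h & Hc & Hh & ->) Hab. apply Ha.
    rewrite <- (gmulKV G a (gmul c h)), ginv_mul.
    rewrite gmul_assoc.
    destruct Hab as (d & k & Hd & Hk & E). rewrite E.
    replace (gmul (gmul (gmul d k) (ginv h)) (ginv c))
      with (gmul (gmul d (gmul k (ginv h))) (ginv c)) by (gsimp; auto).
    apply near_mul; [|apply ball_inv; auto].
    exists d, (gmul k (ginv h)); auto using subgroup_mul, subgroup_inv. }
  assert (inside : forall b, near R b -> A (gmul a b)).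
  { assert (K : forall k b, (k <= R)%nat -> ball k b -> A (gmul a b)).
    { induction k as [|k IH]; simpl; intros b Hk Hb.
      - subst; rewrite gmul_1r; auto.
      - destruct Hb as [Hb|(c & s & Hc & Hs & ->)]; [apply IH; auto; lia|].
        assert (Ac : A (gmul a c)) by (apply IH; auto; lia).
        apply NNPP; intros N. rewrite gmul_assoc in N.
        destruct (cut (gmul a c) s) as [F _]; [auto|tauto|].
        apply (far c); auto. apply ball_near, (ball_mono k); auto; lia. }
    intros b (c & h & Hc & Hh & ->). rewrite gmul_assoc, (HA _ _ Hh). eauto. }
  assert (edge : forall p s, coef f s <> 0%Z ->
            (~ near R (gmul (ginv a) p) \/ ~ near R (gmul (ginv a) (gmul p s))) ->
            A (gmul (ginv a) p) <-> A (gmul (ginv a) (gmul p s))).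
  { intros p s Hs D. apply NNPP; intros N. rewrite gmul_assoc in *.
    destruct (cut (gmul (ginv a) p) s) as [F1 F2]; auto. tauto. }
  assert (near_far : forall p, near R p -> ~ near R (gmul (ginv a) p)).
  { intros p Hp Hq. apply (far _ Hq). rewrite gmulVKl; auto. }
  assert (con1 : forall p, near R p -> (A (gmul (ginv a) p) <-> A (ginv a))).
  { assert (K : forall k b, (k <= R)%nat -> ball k b -> (A (gmul (ginv a) b) <-> A (ginv a))).
    { induction k as [|k IH]; simpl; intros b Hk Hb.
      - subst; rewrite gmul_1r; tauto.
      - destruct Hb as [Hb|(c & s & Hc & Hs & ->)]; [apply IH; auto; lia|].
        rewrite <- edge; auto; [apply IH; auto; lia|].
        left; apply near_far, ball_near, (ball_mono k); auto; lia. }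
    intros p (c & h & Hc & Hh & ->). rewrite gmul_assoc, (HA _ _ Hh). eauto. }
  (* Follow a path from the identity. While it stays outside [A] it cannot cross the translated cut,
     by [inside]; when it leaves [A] it does so at a near point, where [con1] applies afresh. *)
  assert (con2 : forall p, ~ A p -> (A (gmul (ginv a) p) <-> A (ginv a))).
  { apply (gen_ind (fun p => ~ A p -> (A (gmul (ginv a) p) <-> A (ginv a)))).
    - intros _; rewrite gmul_1r; tauto.
    - intros p s IH Hs N. destruct (classic (A p)) as [Ap|Np].
      + apply con1. apply cut; tauto.
      + rewrite <- edge; auto. left. intros D. apply Np.
        rewrite <- (gmulVKl G a p); auto. }
  assert (con : forall p, ~ A p \/ near R p -> (A (gmul (ginv a) p) <-> A (ginv a)))
    by (intros p [|]; auto).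
  destruct (classic (A (ginv a))) as [Y|N].
  - intros p Hp. apply con; auto.
  - exfalso.
    assert (HnA : invariant H (fun p => ~ A p))
      by (intros p h Hh; rewrite (HA _ _ Hh); auto).
    (* Here translation by the inverse of [a] sends the whole set into the complement of [A], so
       recurrence would put [p0] there. *)
    refine (recurrence (fun p => ~ A p \/ near R p) (fun p => ~ A p) a HnA _ _ p0 _ Ap0);
      auto.
    intros p Hp; rewrite con; auto.
Qed.

(** Given a deep point on each side, the two translations compose to one sending [A] and all near
    points into [A]. By recurrence every near point lies in [A], which fails at the outer end of a
    boundary edge. *)
Lemma cut_near_small R A :
  invariant H A -> cut_near R A ->
  (forall p, A p -> near (R + R) p) \/ (forall p, ~ A p -> near (R + R) p).
Proof.
  intros HA cut. apply NNPP; intros N. apply not_or_and in N as [Na Nb].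
  apply not_all_ex_not in Na as [a Na]. apply imply_to_and in Na as [Aa Ha].
  apply not_all_ex_not in Nb as [b Nb]. apply imply_to_and in Nb as [Ab Hb].
  assert (bd : exists p s, coef f s <> 0%Z /\ A p /\ ~ A (gmul p s)).
  { apply NNPP; intros N. apply Ab. rewrite <- (gmulVKl G a b).
    generalize (gmul (ginv a) b). apply gen_ind; [rewrite gmul_1r; auto|].
    intros p s Hp Hs. apply NNPP; intros M. apply N.
    exists (gmul a p), s; rewrite <- gmul_assoc; auto. }
  destruct bd as (p & s & Hs & Ap & Aps).
  destruct (cut p s Hs) as [Np Nps]; [tauto|].
  assert (HnA : invariant H (fun p => ~ A p))
    by (intros q h Hh; rewrite (HA _ _ Hh); auto).
  assert (ncut : cut_near R (fun p => ~ A p)) by (intros q t Ht D; apply cut; tauto).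
  assert (Ka := deep_translate_covers R A a p HA cut Aa Ha Ap Np).
  assert (Kb := deep_translate_covers R _ b (gmul p s) HnA ncut Ab Hb Aps Nps).
  cbv beta in Kb.
  apply Aps. apply (recurrence (fun q => A q \/ near R q) A (gmul b a)); auto.
  intros q Hq. rewrite ginv_mul, <- gmul_assoc. apply Ka. left. apply Kb.
  destruct Hq; auto.
Qed.

End FiniteQuotient.

(** * Integer potentials with localized Laplacian *)

(* Peel off the top level set of [g]: at its boundary the Laplacian is positive, so its cut is
   localized, hence it is either cobounded or bounded; in the latter case lower it by one. *)
Lemma potential_localized (N R : nat) :
  exists R' : nat, (R <= R')%nat /\
  forall H, finite_index_normal G H -> forall (g : G -> Z) (m : Z),
    invariant H g -> (forall p, lap (fun q => IZR (g q)) p <> 0 -> near H R p) ->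
    (forall p, (m - Z.of_nat N <= g p <= m)%Z) ->
    exists c, forall p, g p <> c -> near H R' p.
Proof.
  revert R; induction N as [|N IH]; intros R.
  - exists R; split; auto. intros H HH g m _ _ B. exists m; intros p Hp.
    specialize (B p); lia.
  (* [S R] covers both ends of each edge of the top cut, the doubling comes from [cut_near_small],
     and the outer successor reaches the neighbours of the top set, where lowering it changes the
     Laplacian. *)
  - destruct (IH (S (S R + S R))) as [R' [HR' IHR]].
    exists R'; split; [lia|]. intros H HH g m Hg L B.
    set (A := fun p => g p = m).
    assert (HA : invariant H A) by (intros p h Hh; unfold A; rewrite (Hg _ _ Hh); auto).
    assert (top : forall p s, coef f s <> 0%Z -> A p -> ~ A (gmul p s) -> near H R p).
    { intros p s Hs Ap Aps. apply L.
      assert (M := lap_at_max (fun q => IZR (g q)) p s).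
      assert (IZR (g (gmul p s)) < IZR (g p)).
      { apply IZR_lt. unfold A in *. specialize (B (gmul p s)). lia. }
      assert (IZR (g p) - IZR (g (gmul p s)) <= lap (fun q => IZR (g q)) p).
      { apply M; auto. intros q; apply IZR_le. unfold A in Ap. rewrite Ap. apply B. }
      lra. }
    assert (cut : cut_near H (S R) A).
    { intros p s Hs D. destruct (classic (A p)) as [Y|Y].
      - assert (near H R p) by (apply (top p s); tauto).
        split; [apply (near_mono H R); auto|apply near_step; auto].
      - assert (near H R (gmul p s)).
        { apply (top _ (ginv s)); [rewrite coef_inv; auto|tauto|rewrite gmulKV; auto]. }
        split; [|apply (near_mono H R); auto].
        rewrite <- (gmulKV G p s). apply near_step; auto. rewrite coef_inv; auto. }
    destruct (cut_near_small H HH (S R) A HA cut) as [small|cobounded].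
    + set (g' := fun p => if Z.eq_dec (g p) m then (m - 1)%Z else g p).
      destruct (IHR H HH g' (m - 1)%Z) as [c Hc].
      * intros p h Hh; unfold g'; rewrite (Hg _ _ Hh); auto.
      * intros p Hp. destruct (classic (lap (fun q => IZR (g q)) p = 0)) as [E|E].
        -- destruct (classic (exists s, coef f s <> 0%Z /\ A (gmul p s))) as [(s & Hs & As)|Hno].
           ++ rewrite <- (gmulKV G p s). apply (near_step H HH).
              ** apply small; auto.
              ** rewrite coef_inv; auto.
           ++ exfalso; apply Hp. rewrite <- E. apply rsum_ext; intros s _.
              destruct (Z.eq_dec (coef f s) 0) as [Z0|Z0]; [rewrite Z0; ring|].
              unfold g'. destruct (Z.eq_dec (g (gmul p s)) m) as [As|]; auto.
              exfalso; apply Hno; exists s; auto.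
        -- apply (near_mono H R); [lia|]. apply L; auto.
      * intros p. specialize (B p). unfold g'. destruct (Z.eq_dec (g p) m); lia.
      * exists c; intros p Hp. destruct (Z.eq_dec (g p) m) as [E|E].
        -- apply (near_mono H (S R + S R)); [lia|]. apply small; auto.
        -- apply Hc. unfold g'. destruct (Z.eq_dec (g p) m); tauto.
    + exists m; intros p Hp. apply (near_mono H (S R + S R)); [lia|]. apply cobounded; auto.
Qed.

(** Summation by parts: [h] is [lap g], and [lap] is self-adjoint. The list [E] contains the support
    of [g] and its neighbours, so the reindexing loses no term. *)
Lemma pairing_via_potential (F E : list G) (h : G -> Z) (g x : G -> R) :
  NoDup F -> NoDup E -> incl F E -> (forall u, g u <> 0 -> In u E) ->
  (forall u s, g u <> 0 -> coef f s <> 0%Z -> In (gmul u s) E) ->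
  (forall t, lap g t = if in_dec eq_dec t F then IZR (h t) else 0) ->
  pairing F h x = rsum E (fun u => g u * lap x u).
Proof.
  intros HF HE FE gE gE' Lg.
  transitivity (rsum E (fun t => lap g t * x t)).
  - transitivity (rsum F (fun t => lap g t * x t)).
    + apply rsum_ext; intros t Ht. rewrite Lg. destruct (in_dec eq_dec t F); tauto.
    + apply rsum_support; auto; intros t Ht; [|apply FE];
        rewrite Lg in Ht; destruct (in_dec eq_dec t F); auto; exfalso; apply Ht; ring.
  - unfold lap.
    transitivity (rsum (supp f) (fun s => IZR (coef f s) * rsum E (fun t => g (gmul t s) * x t))).
    + transitivity (rsum E (fun t => rsum (supp f) (fun s =>
        IZR (coef f s) * (g (gmul t s) * x t)))).
      * apply rsum_ext; intros t _. rewrite Rmult_comm, <- rsum_scal.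
        apply rsum_ext; intros; ring.
      * rewrite rsum_swap. apply rsum_ext; intros s _. apply rsum_scal.
    + transitivity (rsum (supp f) (fun s => rsum E (fun u => g u * x (gmul u s)) * IZR (coef f s))).
      * rewrite (rsum_coef_inv (fun s => rsum E (fun u => g u * x (gmul u s)))).
        apply rsum_ext; intros s _. rewrite Rmult_comm.
        destruct (Z.eq_dec (coef f s) 0) as [Z0|Z0]; [rewrite Z0; ring|].
        f_equal. symmetry.
        transitivity (rsum (map (fun u => gmul u (ginv s)) E)
                        (fun t => g (gmul t s) * x t)).
        -- rewrite rsum_map. apply rsum_ext; intros u _. rewrite gmulVK; auto.
        -- apply rsum_support; auto.
           ++ apply FinFun.Injective_map_NoDup; auto.
              intros a b Eab. rewrite <- (gmulVK G a s), Eab. apply gmulVK.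
           ++ intros t Ht. apply in_map_iff. exists (gmul t s); split; [apply gmulKV|].
              apply gE. intros K; apply Ht; rewrite K; ring.
           ++ intros t Ht. rewrite <- (gmulKV G t s). apply gE'; [|rewrite coef_inv; auto].
              intros K; apply Ht; rewrite K; ring.
      * transitivity (rsum (supp f) (fun s => rsum E (fun u =>
          g u * (x (gmul u s) * IZR (coef f s))))).
        -- apply rsum_ext; intros s _. rewrite Rmult_comm, <- rsum_scal.
           apply rsum_ext; intros; ring.
        -- rewrite rsum_swap. apply rsum_ext; intros u _. apply rsum_scal.
Qed.

(** Unless [g] is constant, its extrema sit where the Laplacian is nonzero, hence within [R] steps
    of the identity modulo [H], where the gradient bound controls [g]. *)
Lemma potential_bounded H (HH : finite_index_normal G H) (g : G -> Z) (R : nat) (C : Z) :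
  invariant H g -> (0 <= C)%Z ->
  (forall p, lap (fun q => IZR (g q)) p <> 0 -> near H R p) ->
  (forall p s, coef f s <> 0%Z -> (Z.abs (g (gmul p s) - g p) <= C)%Z) ->
  forall p, (Z.abs (g p - g gone) <= Z.of_nat R * C)%Z.
Proof.
  intros Hg HC L grad.
  assert (K : forall k p, ball k p -> (Z.abs (g p - g gone) <= Z.of_nat k * C)%Z).
  { induction k as [|k IH]; simpl ball; intros p Hp.
    - subst; lia.
    - destruct Hp as [Hp|(b & s & Hb & Hs & ->)]; [specialize (IH _ Hp); nia|].
      specialize (IH _ Hb). specialize (grad b s Hs). nia. }
  assert (K' : forall p, near H R p -> (Z.abs (g p - g gone) <= Z.of_nat R * C)%Z).
  { intros p (b & h & Hb & Hh & ->). rewrite (Hg _ _ Hh); auto. }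
  assert (Hg' : invariant H (fun q => IZR (g q)))
    by (intros p h Hh; rewrite (Hg _ _ Hh); auto).
  destruct (max_principle H HH _ Hg') as [m [Hm D]].
  destruct (min_principle H HH _ Hg') as [n [Hn D']].
  cbv beta in *.
  assert (const : forall m, (forall q, IZR (g q) = IZR (g m)) ->
            forall p, (Z.abs (g p - g gone) <= Z.of_nat R * C)%Z).
  { intros r Hr p. assert (E := Hr p). rewrite <- (Hr gone) in E. apply eq_IZR in E. nia. }
  destruct D as [D|D]; [|eauto]. destruct D' as [D'|D']; [|eauto].
  intros p. assert (Km : near H R m) by (apply L; lra). assert (Kn : near H R n) by (apply L; lra).
  apply K' in Km, Kn. specialize (Hm p). specialize (Hn p). apply le_IZR in Hm, Hn. lia.
Qed.

Lemma annihilator_descends_to_Xf (F : list G) (h : G -> Z) :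
  NoDup F ->
  exists K : nat, forall H, finite_index_normal G H ->
    (forall g, ball K g -> H g -> g = gone) ->
    (forall y, periodic_solution H y -> is_int (pairing F h y)) ->
    forall x, (forall p, is_int (lap x p)) -> is_int (pairing F h x).
Proof.
  intros HF. destruct (list_in_ball F) as [R HR].
  set (C := fold_right Z.add 0%Z (map (fun t => Z.abs (h t)) F)).
  assert (EC : rsum F (fun t => Rabs (IZR (h t))) = IZR C).
  { unfold C, rsum. clear. induction F; simpl; auto. rewrite plus_IZR, IHF, abs_IZR; auto. }
  assert (HC : (0 <= C)%Z) by (unfold C; clear; induction F; simpl; lia).
  (* By [potential_bounded], [g] ranges over an interval of length at most [2 R C] centred at
     [g gone]. *)
  destruct (potential_localized (Z.to_nat (2 * (Z.of_nat R * C))) R) as [R' [HRR' loc]].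
  (* Large enough for two comparisons modulo [H]: a point of the ball of radius [R' + 2] with one of
     radius [R'], and a point of radius [R' + 1] with one of radius [R]. *)
  exists (R' + S (S R') + R)%nat. intros H HH inj A x Hx.
  destruct (annihilator_is_principal H HH F h A) as (g & Hg & Lg & grad).
  assert (Lnear : forall p, lap (fun q => IZR (g q)) p <> 0 -> near H R p).
  { intros p Hp. apply NNPP; intros N. apply Hp. rewrite Lg. apply rsum_zero; intros t Ht.
    rewrite ind_out; [ring|]. intros K. apply N. exists t, (gmul (ginv t) p).
    repeat split; auto.
    - replace (gmul (ginv t) p) with (ginv (gmul (ginv p) t)) by (gsimp; auto).
      apply (subgroup_inv H HH); auto.
    - rewrite gmulVKl; auto. }
  assert (bd := potential_bounded H HH g R C Hg HC Lnear).
  destruct (loc H HH g (g gone + Z.of_nat R * C)%Z Hg Lnear) as [c Hc].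
  { intros p. rewrite Z2Nat.id by nia.
    assert (Z.abs (g p - g gone) <= Z.of_nat R * C)%Z; [|lia].
    apply bd. intros q s Hs. apply le_IZR. rewrite abs_IZR, minus_IZR, <- EC. auto. }
  (* The lift of [g - c], cut off outside a single copy of the ball. By injectivity it agrees with
     [g - c] two steps further out, so its Laplacian is correct one step further out. *)
  set (g' := fun u => if excluded_middle_informative (ball R' u) then IZR (g u) - IZR c else 0).
  assert (g'in : forall u, g' u <> 0 -> ball R' u).
  { intros u; unfold g'; destruct (excluded_middle_informative (ball R' u)); tauto. }
  assert (g'eq : forall u, ball (S (S R')) u -> g' u = IZR (g u) - IZR c).
  { intros u Hu; unfold g'; destruct (excluded_middle_informative (ball R' u)) as [|N]; auto.
    destruct (Z.eq_dec (g u) c) as [->|E]; [ring|]. exfalso; apply N.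
    destruct (Hc u E) as (b & k & Hb & Hk & ->).
    assert (k = gone).
    { apply inj; auto. apply (ball_mono (R' + S (S R'))); [lia|].
      rewrite <- (gmulKl G b k). apply ball_mul; auto. apply ball_inv; auto. }
    subst; rewrite gmul_1r; auto. }
  destruct (ball_finite (S R')) as [E0 HE0]. set (E := nodup eq_dec E0).
  assert (HE : forall u, ball (S R') u -> In u E) by (intros; apply nodup_In; auto).
  rewrite (pairing_via_potential F E h g' x); auto.
  - apply rsum_is_int; intros u _. apply is_int_mult; auto.
    unfold g'; destruct (excluded_middle_informative (ball R' u)).
    + exists (g u - c)%Z; rewrite minus_IZR; auto.
    + exists 0%Z; auto.
  - apply NoDup_nodup.
  - intros t Ht. apply HE, (ball_mono R); auto.
  - intros u Hu. apply HE; left; auto.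
  - intros u s Hu Hs. apply HE, ball_step; auto.
  - intros t. destruct (classic (ball (S R') t)) as [Bt|Bt].
    + transitivity (lap (fun q => IZR (g q) - IZR c) t).
      * apply rsum_ext; intros s _.
        destruct (Z.eq_dec (coef f s) 0) as [Z0|Z0]; [rewrite Z0; ring|].
        rewrite g'eq; auto. apply ball_step; auto.
      * rewrite lap_minus, lap_const, Lg, Rminus_0_r.
        transitivity (rsum F (fun u => if eq_dec u t then IZR (h t) else 0)).
        -- apply rsum_ext; intros u Hu. destruct (eq_dec u t) as [->|N].
           ++ rewrite gmul_Vl, ind_in; [ring|apply (subgroup_one H HH)].
           ++ rewrite ind_out; [ring|]. intros K. apply N.
              assert (gmul (ginv t) u = gone).
              { apply inj; auto. apply (ball_mono (S R' + R)); [lia|].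
                apply ball_mul; auto. apply ball_inv; auto. }
              rewrite <- (gmulVKl G t u), H0, gmul_1r; auto.
        -- destruct (in_dec eq_dec t F) as [It|It].
           ++ transitivity (rsum (t :: nil) (fun u => if eq_dec u t then IZR (h t) else 0)).
              ** apply rsum_support; auto.
                 --- constructor; [simpl; tauto|constructor].
                 --- intros u; destruct (eq_dec u t); [subst; auto|tauto].
                 --- intros u; destruct (eq_dec u t); [subst; simpl; auto|tauto].
              ** unfold rsum; simpl. destruct (eq_dec t t); [ring|tauto].
           ++ apply rsum_zero; intros u Hu. destruct (eq_dec u t); [subst; tauto|auto].
    + destruct (in_dec eq_dec t F) as [It|It].
      * exfalso; apply Bt, (ball_mono R); auto.
      * apply rsum_zero; intros s _.
        destruct (Z.eq_dec (coef f s) 0) as [Z0|Z0]; [rewrite Z0; ring|].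
        replace (g' (gmul t s)) with 0; [ring|]. apply NNPP; intros N. apply Bt.
        rewrite <- (gmulKV G t s). apply ball_step; [auto|rewrite coef_inv; auto].
Qed.

End WellBalanced.

(** * Positive definite trigonometric polynomials *)

Lemma cos_shift_int x a : is_int a -> cos (x + 2 * PI * a) = cos x.
Proof.
  intros [k ->].
  assert (K : forall y n, cos (y + 2 * PI * INR n) = cos y).
  { intros y n. rewrite <- (cos_period y n). f_equal; ring. }
  destruct (Z_le_gt_dec 0 k).
  - rewrite <- (Z2Nat.id k), <- INR_IZR_INZ by lia. apply K.
  - rewrite <- (K _ (Z.to_nat (- k))). f_equal.
    rewrite INR_IZR_INZ, Z2Nat.id, opp_IZR by lia. ring.
Qed.

Lemma sin_pi_neq_0 a : ~ is_int a -> sin (PI * a) <> 0.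
Proof.
  intros N E. apply N. destruct (sin_eq_0_0 _ E) as [k Hk]. exists k.
  apply Rmult_eq_reg_l with PI; [lra|apply PI_neq0].
Qed.

Fixpoint nsum (T : nat) (u : nat -> R) : R :=
  match T with O => 0 | S T => nsum T u + u T end.

Lemma nsum_ext T u v : (forall k, u k = v k) -> nsum T u = nsum T v.
Proof. intros E; induction T; simpl; auto. rewrite IHT, E; auto. Qed.

Lemma nsum_plus T u v : nsum T (fun k => u k + v k) = nsum T u + nsum T v.
Proof. induction T; simpl; lra. Qed.

Lemma nsum_scal T c u : nsum T (fun k => c * u k) = c * nsum T u.
Proof. induction T; simpl; lra. Qed.

Lemma nsum_const T c : nsum T (fun _ => c) = INR T * c.
Proof. induction T; [simpl; lra|]. rewrite S_INR; simpl nsum; lra. Qed.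

Lemma nsum_le T u v : (forall k, u k <= v k) -> nsum T u <= nsum T v.
Proof. intros E; induction T; simpl; [lra|]. specialize (E T); lra. Qed.

Lemma nsum_rsum {A} T (l : list A) (u : nat -> A -> R) :
  nsum T (fun k => rsum l (u k)) = rsum l (fun a => nsum T (fun k => u k a)).
Proof.
  induction T; simpl.
  - rewrite rsum_zero; auto.
  - rewrite IHT, <- rsum_plus; auto.
Qed.

Lemma cos_progression_sum T x a :
  2 * sin (PI * a) * nsum T (fun k => cos (2 * PI * (x + INR k * a))) =
  sin (2 * PI * (x + INR T * a) - PI * a) - sin (2 * PI * x - PI * a).
Proof.
  induction T as [|T IH].
  - simpl. rewrite Rmult_0_r, Rmult_0_l, Rplus_0_r. ring.
  - simpl nsum. rewrite Rmult_plus_distr_l, IH, S_INR.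
    replace (2 * PI * (x + (INR T + 1) * a) - PI * a)
      with (2 * PI * (x + INR T * a) + PI * a) by ring.
    rewrite sin_plus, (sin_minus (2 * PI * (x + INR T * a))). ring.
Qed.

Lemma cos_progression_bounded x a :
  ~ is_int a ->
  exists B, forall T, Rabs (nsum T (fun k => cos (2 * PI * (x + INR k * a)))) <= B.
Proof.
  intros N. apply sin_pi_neq_0 in N. exists (/ Rabs (sin (PI * a))). intros T.
  assert (E := cos_progression_sum T x a).
  assert (P := Rabs_pos_lt _ N).
  assert (b1 := SIN_bound (2 * PI * (x + INR T * a) - PI * a)).
  assert (b2 := SIN_bound (2 * PI * x - PI * a)).
  assert (L : Rabs (2 * sin (PI * a) * nsum T (fun k => cos (2 * PI * (x + INR k * a)))) <= 2)
    by (rewrite E; apply Rabs_le; lra).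
  rewrite !Rabs_mult, (Rabs_right 2) in L by lra.
  apply Rmult_le_reg_l with (Rabs (sin (PI * a))); auto.
  rewrite Rinv_r; lra.
Qed.

(** A full period of the geometric sum: [k / (M+1)] is not an integer, while [M+1] steps advance by
    the integer [k]. *)
Lemma cos_progression_vanish M k :
  (0 < k <= M)%nat ->
  nsum (S M) (fun j => cos (INR k * (2 * PI * (INR j / INR (S M))))) = 0.
Proof.
  intros Hk. assert (P : INR (S M) <> 0) by (apply not_0_INR; lia).
  set (a := INR k / INR (S M)).
  assert (N : ~ is_int a).
  { intros [j Hj]. assert (E : INR k = IZR j * INR (S M)) by (rewrite <- Hj; unfold a; field; auto).
    rewrite !INR_IZR_INZ, <- mult_IZR in E. apply eq_IZR in E.
    destruct (Z_le_gt_dec j 0); nia. }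
  assert (E := cos_progression_sum (S M) 0 a).
  rewrite (nsum_ext _ _ (fun j => cos (2 * PI * (0 + INR j * a))))
    by (intros j; f_equal; unfold a; field; auto).
  apply sin_pi_neq_0 in N. apply Rmult_eq_reg_l with (2 * sin (PI * a)); [|lra].
  rewrite E, (Rmult_0_r (2 * sin (PI * a))). apply Rminus_diag_eq.
  replace (INR (S M) * a) with (INR k) by (unfold a; field; auto).
  rewrite <- (cos_shift (2 * PI * (0 + INR k) - PI * a)), <- (cos_shift (2 * PI * 0 - PI * a)).
  rewrite <- (cos_shift_int (PI / 2 - (2 * PI * (0 + INR k) - PI * a)) (INR k))
    by (exists (Z.of_nat k); apply INR_IZR_INZ).
  f_equal; ring.
Qed.

Lemma rsum_app {A} (l m : list A) u : rsum (l ++ m) u = rsum l u + rsum m u.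
Proof. unfold rsum; induction l; simpl; lra. Qed.

Lemma rsum_flat_map {A B} (l : list A) (k : A -> list B) u :
  rsum (flat_map k l) u = rsum l (fun a => rsum (k a) u).
Proof.
  induction l as [|a l IH]; auto. simpl; rewrite rsum_app, IH; auto.
Qed.

(** Equal to 1 at multiples of [2 PI], geometrically small in [M] away from them, with nonnegative
    Fourier coefficients. *)
Definition bump (M : nat) (u : R) : R := ((1 + cos u) / 2) ^ M.

Lemma bump_bounds M u : 0 <= bump M u <= 1.
Proof.
  assert (b := COS_bound u). unfold bump. split; [apply pow_le; lra|].
  apply Rle_trans with (1 ^ M); [apply pow_incr|rewrite pow1]; lra.
Qed.

Lemma bump_expansion M :
  exists l : list (R * nat), (forall c, In c l -> 0 <= fst c /\ (snd c <= M)%nat) /\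
    forall u, bump M u = rsum l (fun c => fst c * cos (INR (snd c) * u)).
Proof.
  unfold bump; induction M as [|M [l [Hl El]]].
  - exists ((1, O) :: nil); split.
    + intros c [<-|[]]; simpl; split; [lra|lia].
    + intros u; unfold rsum; simpl. rewrite Rmult_0_l, cos_0; ring.
  (* Multiplication by [(1 + cos u) / 2] keeps half of frequency [k] and sends a quarter to each of
     [k + 1] and [|k - 1|]; the [match] computes the latter, which is 1 at [k = 0]. *)
  - exists (flat_map (fun c => (fst c / 2, snd c) :: (fst c / 4, S (snd c)) ::
        (fst c / 4, match snd c with O => 1%nat | S k => k end) :: nil) l); split.
    + intros c Hc. apply in_flat_map in Hc as [[b k] [Hb Hc]].
      destruct (Hl _ Hb) as [H1 H2]; simpl in *.
      destruct Hc as [<-|[<-|[<-|[]]]]; simpl; split; try lra; try lia.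
      destruct k; lia.
    + intros u. rewrite rsum_flat_map. simpl pow. rewrite El, <- rsum_scal.
      apply rsum_ext; intros [b k] _. unfold rsum; cbn [map fold_right fst snd].
      replace (INR (S k) * u) with (INR k * u + u) by (rewrite S_INR; ring).
      replace (cos (INR (match k with O => 1%nat | S k => k end) * u))
        with (cos (INR k * u - u)).
      * rewrite cos_plus, cos_minus. field.
      * destruct k.
        -- simpl INR. rewrite <- cos_neg. f_equal; ring.
        -- rewrite S_INR. f_equal; ring.
Qed.

(* The mean of [bump M] over the [M+1]-st roots of unity is its constant coefficient, and the
   term at [1] alone contributes [1/(M+1)]. *)
Lemma bump_constant_coef M :
  exists (a : R) (l : list (R * nat)), / INR (S M) <= a /\ (forall c, In c l -> 0 <= fst c) /\
    forall u, bump M u = a + rsum l (fun c => fst c * cos (INR (snd c) * u)).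
Proof.
  destruct (bump_expansion M) as [l [Hl El]].
  set (a := rsum l (fun c => match snd c with O => fst c | _ => 0 end)).
  exists a, (map (fun c => (match snd c with O => 0 | _ => fst c end, snd c)) l).
  assert (P : 0 < INR (S M)) by (apply lt_0_INR; lia).
  split; [|split].
  - assert (E : nsum (S M) (fun j => bump M (2 * PI * (INR j / INR (S M)))) = INR (S M) * a).
    { rewrite (nsum_ext _ _ (fun j => rsum l (fun c =>
         fst c * cos (INR (snd c) * (2 * PI * (INR j / INR (S M))))))) by (intros; apply El).
      rewrite nsum_rsum. unfold a. rewrite <- rsum_scal.
      apply rsum_ext; intros [b k] Hc. cbn [fst snd]. rewrite nsum_scal.
      destruct k.
      - rewrite (nsum_ext _ _ (fun _ => 1)), nsum_const; [ring|].
        intros j; rewrite Rmult_0_l; apply cos_0.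
      - rewrite cos_progression_vanish; [ring|]. destruct (Hl _ Hc); simpl in *; lia. }
    assert (L : forall n, 1 <= nsum (S n) (fun j => bump M (2 * PI * (INR j / INR (S M))))).
    { induction n as [|n IH].
      - assert (b0 : bump M (2 * PI * (INR 0 / INR (S M))) = 1).
        { unfold bump. replace (2 * PI * (INR 0 / INR (S M))) with 0
            by (change (INR 0) with 0; unfold Rdiv; ring).
          rewrite cos_0. replace ((1 + 1) / 2) with 1 by field. apply pow1. }
        cbn [nsum]. rewrite b0; lra.
      - assert (b := bump_bounds M (2 * PI * (INR (S n) / INR (S M)))).
        eapply Rle_trans; [exact IH|].
        rewrite <- (Rplus_0_r (nsum (S n) _)). apply Rplus_le_compat_l; lra. }
    specialize (L M).
    rewrite E in L. apply Rmult_le_reg_l with (INR (S M)); auto. rewrite Rinv_r; lra.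
  - intros c Hc. apply in_map_iff in Hc as [[b k] [<- Hb]]. simpl.
    destruct (Hl _ Hb); simpl in *. destruct k; lra.
  - intros u. rewrite El, rsum_map. unfold a. rewrite <- rsum_plus.
    apply rsum_ext; intros [b k] _. cbn [fst snd]. destruct k; [|ring].
    rewrite Rmult_0_l, cos_0. ring.
Qed.

Section TrigPolynomials.
Variable G : Group.
Variable F : list G.
Hypothesis HF : NoDup F.

Definition trig (l : list (R * (G -> Z))) (z : G -> R) : R :=
  rsum l (fun c => fst c * cos (2 * PI * pairing G F (snd c) z)).

Lemma pairing_plus_freq h k z :
  pairing G F (fun t => h t + k t)%Z z = pairing G F h z + pairing G F k z.
Proof.
  unfold pairing; rewrite <- rsum_plus; apply rsum_ext; intros; rewrite plus_IZR; ring.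
Qed.

Lemma pairing_minus_freq h k z :
  pairing G F (fun t => h t - k t)%Z z = pairing G F h z - pairing G F k z.
Proof.
  unfold pairing; rewrite <- rsum_minus; apply rsum_ext; intros; rewrite minus_IZR; ring.
Qed.

Lemma pairing_line h z y k :
  pairing G F h (fun t => z t + k * y t) = pairing G F h z + k * pairing G F h y.
Proof.
  unfold pairing; rewrite <- rsum_scal, <- rsum_plus; apply rsum_ext; intros; ring.
Qed.

Lemma pairing_single t k z :
  In t F -> pairing G F (fun u => if eq_dec u t then Z.of_nat k else 0%Z) z = INR k * z t.
Proof.
  intros Ht. unfold pairing.
  rewrite (rsum_support F (t :: nil)); auto.
  - unfold rsum; simpl. destruct (eq_dec t t); [|tauto]. rewrite <- INR_IZR_INZ; ring.
  - constructor; [simpl; tauto|constructor].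
  - intros u. destruct (eq_dec u t) as [->|]; auto. intros K; exfalso; apply K; ring.
  - intros u. destruct (eq_dec u t) as [->|]; simpl; auto. intros K; exfalso; apply K; ring.
Qed.

Lemma trig_mul l m :
  (forall c, In c l -> 0 <= fst c) -> (forall c, In c m -> 0 <= fst c) ->
  exists n, (forall c, In c n -> 0 <= fst c) /\ forall z, trig n z = trig l z * trig m z.
Proof.
  intros Hl Hm.
  exists (flat_map (fun c => flat_map (fun d =>
    (fst c * fst d / 2, fun t => (snd c t + snd d t)%Z) ::
    (fst c * fst d / 2, fun t => (snd c t - snd d t)%Z) :: nil) m) l). split.
  - intros e He. apply in_flat_map in He as [c [Hc He]].
    apply in_flat_map in He as [d [Hd He]].
    assert (0 <= fst c * fst d) by (apply Rmult_le_pos; auto).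
    destruct He as [<-|[<-|[]]]; simpl; lra.
  - intros z. unfold trig. rewrite rsum_flat_map, (Rmult_comm (rsum l _)), <- rsum_scal.
    apply rsum_ext; intros c _. rewrite rsum_flat_map.
    rewrite (Rmult_comm (rsum m _)), <- rsum_scal. apply rsum_ext; intros d _.
    unfold rsum; cbn [map fold_right fst snd].
    rewrite pairing_plus_freq, pairing_minus_freq, Rmult_plus_distr_l, Rmult_minus_distr_l.
    rewrite cos_plus, cos_minus. field.
Qed.

Lemma trig_scal a l :
  0 <= a -> (forall c, In c l -> 0 <= fst c) ->
  exists n, (forall c, In c n -> 0 <= fst c) /\ forall z, trig n z = a * trig l z.
Proof.
  intros Ha Hl. exists (map (fun c => (a * fst c, snd c)) l). split.
  - intros c Hc. apply in_map_iff in Hc as [d [<- Hd]]. simpl. apply Rmult_le_pos; auto.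
  - intros z. unfold trig. rewrite rsum_map, <- rsum_scal. apply rsum_ext; intros; simpl; ring.
Qed.

Definition bump_prod (M : nat) (L : list G) (z : G -> R) : R :=
  fold_right Rmult 1 (map (fun t => bump M (2 * PI * z t)) L).

Lemma bump_prod_bounds M L z : 0 <= bump_prod M L z <= 1.
Proof.
  unfold bump_prod; induction L; simpl; [lra|].
  assert (b := bump_bounds M (2 * PI * z a)). split; [apply Rmult_le_pos; lra|].
  apply Rle_trans with (1 * 1); [apply Rmult_le_compat; lra|lra].
Qed.

Lemma bump_prod_le M L z t : In t L -> bump_prod M L z <= bump M (2 * PI * z t).
Proof.
  induction L as [|u L IH]; intros Ht; [destruct Ht|].
  assert (b := bump_bounds M (2 * PI * z u)). assert (b' := bump_prod_bounds M L z).
  change (bump_prod M (u :: L) z) with (bump M (2 * PI * z u) * bump_prod M L z).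
  destruct Ht as [->|Ht]; [nra|]. specialize (IH Ht). nra.
Qed.

Lemma bump_prod_expansion M L :
  incl L F ->
  exists a l, (/ INR (S M)) ^ length L <= a /\ (forall c, In c l -> 0 <= fst c) /\
    forall z, bump_prod M L z = a + trig l z.
Proof.
  assert (P : 0 < / INR (S M)) by (apply Rinv_0_lt_compat, lt_0_INR; lia).
  induction L as [|t L IH]; intros HL.
  - exists 1, nil; split; [simpl; lra|split; [simpl; tauto|]].
    intros z; unfold bump_prod, trig, rsum; simpl; ring.
  - destruct IH as (a & l & Ha & Hl & El); [intros u Hu; apply HL; simpl; auto|].
    destruct (bump_constant_coef M) as (b & k & Hb & Hk & Ek).
    set (m := map (fun c => (fst c, fun u => if eq_dec u t then Z.of_nat (snd c) else 0%Z)) k).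
    assert (Hm : forall c, In c m -> 0 <= fst c).
    { intros c Hc. apply in_map_iff in Hc as [d [<- Hd]]. simpl; auto. }
    assert (Em : forall z, bump M (2 * PI * z t) = b + trig m z).
    { intros z. rewrite Ek. f_equal. unfold trig, m. rewrite rsum_map.
      apply rsum_ext; intros c _. cbn [fst snd].
      rewrite pairing_single by (apply HL; simpl; auto). do 2 f_equal; ring. }
    assert (Pa : 0 < (/ INR (S M)) ^ length L) by (apply pow_lt; auto).
    destruct (trig_mul m l Hm Hl) as (n1 & Hn1 & En1).
    destruct (trig_scal b l) as (n2 & Hn2 & En2); [lra|auto|].
    destruct (trig_scal a m) as (n3 & Hn3 & En3); [lra|auto|].
    (* The expansion of [(b + trig m) * (a + trig l)]: [n1] is the product of the two polynomials,
       [n2] and [n3] are the cross terms. *)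
    exists (b * a), (n1 ++ n2 ++ n3). split; [|split].
    + change ((/ INR (S M)) ^ length (t :: L)) with (/ INR (S M) * (/ INR (S M)) ^ length L).
      apply Rmult_le_compat; lra.
    + intros c Hc. apply in_app_or in Hc as [|Hc]; auto. apply in_app_or in Hc as [|]; auto.
    + intros z.
      change (bump_prod M (t :: L) z) with (bump M (2 * PI * z t) * bump_prod M L z).
      rewrite El, Em. unfold trig at 3. rewrite !rsum_app. fold (trig n1 z) (trig n2 z) (trig n3 z).
      rewrite En1, En2, En3. ring.
Qed.

Definition annihilates (Y : (G -> R) -> Prop) (h : G -> Z) : Prop :=
  forall y, Y y -> is_int (pairing G F h y).

(* Averaging along [z, z + y, z + 2 y, ...] kills the frequencies on which [y] is not integral. *)
Lemma trig_average_line l z y :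
  exists B, forall T,
    INR T * trig (filter (fun c => if excluded_middle_informative (is_int (pairing G F (snd c) y))
                                  then true else false) l) z
    <= nsum T (fun k => trig l (fun t => z t + INR k * y t)) + B.
Proof.
  induction l as [|[c h] l [B IH]].
  - exists 0; intros T. unfold trig, rsum; simpl. rewrite nsum_const; lra.
  - assert (E : forall T, nsum T (fun k => trig ((c, h) :: l) (fun t => z t + INR k * y t)) =
       c * nsum T (fun k => cos (2 * PI * (pairing G F h z + INR k * pairing G F h y))) +
       nsum T (fun k => trig l (fun t => z t + INR k * y t))).
    { intros T. rewrite <- nsum_scal, <- nsum_plus. apply nsum_ext; intros k.
      rewrite <- pairing_line. reflexivity. }
    simpl filter.
    destruct (excluded_middle_informative (is_int (pairing G F h y))) as [I|N].
    + exists B; intros T. rewrite E.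
      rewrite (nsum_ext _ _ (fun _ => cos (2 * PI * pairing G F h z))), nsum_const.
      * specialize (IH T).
        match goal with |- _ * trig (_ :: ?m) z <= _ =>
          change (trig ((c, h) :: m) z) with (c * cos (2 * PI * pairing G F h z) + trig m z) end.
        lra.
      * intros k. rewrite Rmult_plus_distr_l. apply cos_shift_int.
        apply is_int_mult; auto. exists (Z.of_nat k); apply INR_IZR_INZ.
    + destruct (cos_progression_bounded (pairing G F h z) _ N) as [B' HB'].
      exists (B + Rabs c * B'); intros T. rewrite E. specialize (IH T). specialize (HB' T).
      assert (K : Rabs (c * nsum T (fun k =>
          cos (2 * PI * (pairing G F h z + INR k * pairing G F h y)))) <= Rabs c * B').
      { rewrite Rabs_mult. apply Rmult_le_compat_l; [apply Rabs_pos|auto]. }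
      match type of K with Rabs ?u <= _ =>
        assert (K' := Rle_abs (- u)); rewrite Rabs_Ropp in K' end.
      cbn [fst snd] in *. lra.
Qed.

Lemma le_of_linear_bound a m B : (forall T : nat, INR T * a <= INR T * m + B) -> a <= m.
Proof.
  intros K. apply Rnot_lt_le; intros L.
  destruct (INR_unbounded (B / (a - m))) as [n Hn].
  specialize (K n). assert (B < INR n * (a - m)); [|lra].
  apply Rmult_lt_reg_r with (/ (a - m)); [apply Rinv_0_lt_compat; lra|].
  rewrite Rmult_assoc, Rinv_r; [unfold Rdiv in Hn; lra|lra].
Qed.

(** While some frequency is not integral on some [y0] in [Y], averaging along [y0] removes it. The
    bound [m] survives, since the averaged values are all taken on [x + Y]; [n] bounds the number of
    rounds. *)
Lemma trig_average (Y : (G -> R) -> Prop) a m x :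
  (forall y z k, Y y -> Y z -> Y (fun t => y t + INR k * z t)) ->
  forall n l, (length l <= n)%nat ->
  (forall y, Y y -> a + trig l (fun t => x t + y t) <= m) ->
  exists l', incl l' l /\ (forall c, In c l' -> annihilates Y (snd c)) /\
    forall y, Y y -> a + trig l' (fun t => x t + y t) <= m.
Proof.
  intros HY. induction n as [|n IH]; intros l Hlen Hl.
  - destruct l; [|simpl in Hlen; lia]. exists nil; repeat split; auto.
    + apply incl_refl.
    + intros c [].
  - destruct (classic (forall c, In c l -> annihilates Y (snd c))) as [A|N].
    + exists l; repeat split; auto. apply incl_refl.
    + apply not_all_ex_not in N as [[c h] N]. apply imply_to_and in N as [Hc N].
      apply not_all_ex_not in N as [y0 N]. apply imply_to_and in N as [Hy0 N].
      set (p := fun c : R * (G -> Z) =>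
        if excluded_middle_informative (is_int (pairing G F (snd c) y0)) then true else false).
      destruct (IH (filter p l)) as (l' & I & A & L).
      * assert (K := filter_length_le p l).
        destruct (Nat.eq_dec (length (filter p l)) (length l)) as [E|E]; [|lia].
        exfalso. apply filter_length_forallb in E. rewrite forallb_forall in E.
        specialize (E _ Hc). unfold p in E.
        destruct (excluded_middle_informative (is_int (pairing G F (snd (c, h)) y0)));
          [contradiction|discriminate].
      * intros y Hy. destruct (trig_average_line l (fun t => x t + y t) y0) as [B HB].
        apply (le_of_linear_bound _ _ B). intros T. specialize (HB T). fold p in HB.
        assert (K : nsum T (fun k => a + trig l (fun t => x t + y t + INR k * y0 t)) <=
                    nsum T (fun _ => m)).
        { apply nsum_le; intros k.
          replace (fun t => x t + y t + INR k * y0 t) with (fun t => x t + (y t + INR k * y0 t))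
            by (apply functional_extensionality; intros; ring).
          apply (Hl (fun t => y t + INR k * y0 t)); auto. }
        rewrite nsum_plus, !nsum_const in K. lra.
      * exists l'; repeat split; auto. intros c' Hc'. apply I in Hc'.
        apply filter_In in Hc'; tauto.
Qed.

(** The frequencies that survive averaging annihilate [Y], so they are integral at [x]: every cosine
    there is 1 and the polynomial is nonnegative. *)
Lemma trig_positive_on_annihilator (Y : (G -> R) -> Prop) a m x l :
  (forall y z k, Y y -> Y z -> Y (fun t => y t + INR k * z t)) -> Y (fun _ => 0) ->
  (forall c, In c l -> 0 <= fst c) ->
  (forall c, In c l -> annihilates Y (snd c) -> is_int (pairing G F (snd c) x)) ->
  (forall y, Y y -> a + trig l (fun t => x t + y t) <= m) -> a <= m.
Proof.
  intros HY Y0 Hl Hx L.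
  destruct (trig_average Y a m x HY (length l) l) as (l' & I & A & L'); auto.
  specialize (L' _ Y0). assert (0 <= trig l' (fun t => x t + 0)); [|lra].
  replace (fun t => x t + 0) with x by (apply functional_extensionality; intros; ring).
  unfold trig. rewrite <- (rsum_zero l' (fun _ => 0)) by auto.
  apply rsum_le; intros c Hc.
  rewrite <- (Rplus_0_l (2 * PI * pairing G F (snd c) x)), cos_shift_int by (apply Hx; auto).
  rewrite cos_0, Rmult_1_r; auto.
Qed.

End TrigPolynomials.

Lemma cos_far_from_int eps u :
  0 < eps <= / 4 -> (forall k : Z, eps <= Rabs (u - IZR k)) -> cos (2 * PI * u) <= cos (2 * PI * eps).
Proof.
  intros He Hu. assert (P := PI_RGT_0).
  destruct (base_fp u) as [w0 w1]. set (w := frac_part u) in *.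
  assert (Ew : u = w + IZR (Int_part u)) by (unfold w, frac_part; ring).
  clearbody w. revert Ew; generalize (Int_part u); intros i Ew.
  assert (k0 := Hu i). assert (k1 := Hu (i + 1)%Z).
  rewrite plus_IZR in k1. rewrite Ew in k0, k1.
  replace (w + IZR i - IZR i) with w in k0 by ring.
  replace (w + IZR i - (IZR i + 1)) with (- (1 - w)) in k1 by ring.
  rewrite Rabs_right in k0 by lra. rewrite Rabs_Ropp, Rabs_right in k1 by lra.
  rewrite Ew, Rmult_plus_distr_l, cos_shift_int by (eexists; eauto).
  destruct (Rle_dec w (/ 2)).
  - apply cos_decr_1; nra.
  - rewrite <- cos_neg, <- (cos_shift_int (- (2 * PI * w)) 1) by (exists 1%Z; auto).
    replace (- (2 * PI * w) + 2 * PI * 1) with (2 * PI * (1 - w)) by ring.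
    apply cos_decr_1; nra.
Qed.

(** Bernoulli's inequality for [/ q = 1 + d]. *)
Lemma geometric_times_linear_bounded q :
  0 < q < 1 -> exists C, 0 < C /\ forall M, INR (S M) * q ^ M <= C.
Proof.
  intros Hq. set (d := / q - 1).
  assert (Hd : 0 < d) by (unfold d; assert (K := Rinv_lt_contravar q 1); lra).
  exists (1 + / d). split; [assert (0 < / d) by (apply Rinv_0_lt_compat; auto); lra|].
  intros M. assert (B := poly M d Hd).
  assert (E : (1 + d) ^ M * q ^ M = 1).
  { rewrite <- Rpow_mult_distr. replace ((1 + d) * q) with 1 by (unfold d; field; lra). apply pow1. }
  assert (P : 0 < q ^ M) by (apply pow_lt; lra).
  assert (B1 : (1 + INR M * d) * q ^ M <= 1) by (rewrite <- E; apply Rmult_le_compat_r; lra).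
  assert (q ^ M <= 1) by (rewrite <- (pow1 M); apply pow_incr; lra).
  assert (INR M * q ^ M <= / d).
  { apply Rmult_le_reg_l with d; auto. rewrite Rinv_r; lra. }
  rewrite S_INR. lra.
Qed.

(** Writing [q] as [sqrt q * sqrt q], one factor absorbs one power of [M + 1] and the other serves
    the induction. *)
Lemma geometric_times_poly_bounded d :
  forall q, 0 < q < 1 -> exists C, 0 < C /\ forall M, INR (S M) ^ d * q ^ M <= C.
Proof.
  induction d as [|d IH]; intros q Hq.
  - exists 1; split; [lra|]. intros M. rewrite pow_O, Rmult_1_l, <- (pow1 M).
    apply pow_incr; lra.
  - assert (Hs : 0 < sqrt q < 1).
    { split; [apply sqrt_lt_R0; lra|]. rewrite <- sqrt_1. apply sqrt_lt_1; lra. }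
    destruct (IH _ Hs) as [C [HC1 HC]].
    destruct (geometric_times_linear_bounded _ Hs) as [D [HD1 HD]].
    exists (D * C); split; [apply Rmult_lt_0_compat; auto|]. intros M.
    rewrite <- (sqrt_sqrt q) by lra. rewrite Rpow_mult_distr.
    change (INR (S M) ^ S d) with (INR (S M) * INR (S M) ^ d).
    replace (INR (S M) * INR (S M) ^ d * (sqrt q ^ M * sqrt q ^ M))
      with ((INR (S M) * sqrt q ^ M) * (INR (S M) ^ d * sqrt q ^ M)) by ring.
    assert (0 <= INR (S M)) by apply pos_INR.
    assert (0 <= sqrt q ^ M) by (apply pow_le; lra).
    apply Rmult_le_compat; auto; apply Rmult_le_pos; auto; apply pow_le; auto.
Qed.

Lemma geometric_beats_poly d q : 0 < q < 1 -> exists M, q ^ M < (/ INR (S M)) ^ d.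
Proof.
  intros Hq.
  assert (Hs : 0 < sqrt q < 1).
  { split; [apply sqrt_lt_R0; lra|]. rewrite <- sqrt_1. apply sqrt_lt_1; lra. }
  destruct (geometric_times_poly_bounded d _ Hs) as [C [HC1 HC]].
  destruct (pow_lt_1_zero (sqrt q)) with (y := / C) as [M HM].
  - rewrite Rabs_right; lra.
  - apply Rinv_0_lt_compat; auto.
  - exists M. specialize (HM M (le_n M)). specialize (HC M).
    assert (P : 0 < sqrt q ^ M) by (apply pow_lt; lra).
    rewrite Rabs_right in HM by lra.
    assert (Pi : 0 < INR (S M) ^ d) by (apply pow_lt, lt_0_INR; lia).
    rewrite pow_inv. apply Rmult_lt_reg_l with (INR (S M) ^ d); auto.
    rewrite Rinv_r by lra.
    rewrite <- (sqrt_sqrt q) at 1 by lra. rewrite Rpow_mult_distr, <- Rmult_assoc.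
    apply Rle_lt_trans with (C * sqrt q ^ M).
    + apply Rmult_le_compat_r; lra.
    + rewrite <- (Rinv_r C) by lra. apply Rmult_lt_compat_l; auto.
Qed.

(* A trigonometric polynomial that is below its constant coefficient away from the integer
   points: the product kernel [((1 + cos 2 pi z) / 2)^M]. *)
Lemma concentrated_kernel (G : Group) (F : list G) eps :
  NoDup F -> 0 < eps <= / 4 ->
  exists a m l, m < a /\ (forall c, In c l -> 0 <= fst c) /\
    forall z, (exists t, In t F /\ forall k : Z, eps <= Rabs (z t - IZR k)) ->
      a + trig G F l z <= m.
Proof.
  intros HF He. assert (P := PI_RGT_0).
  set (q := (1 + cos (2 * PI * eps)) / 2).
  assert (Hq : 0 < q < 1).
  { assert (cos (2 * PI * eps) < 1) by (rewrite <- cos_0; apply cos_decreasing_1; nra).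
    assert (0 <= cos (2 * PI * eps)) by (apply cos_ge_0; nra).
    unfold q; lra. }
  (* The constant coefficient is at least [(1/(M+1))] to the power [length F], while far points give
     at most [q ^ M]. *)
  destruct (geometric_beats_poly (length F) q Hq) as [M HM].
  destruct (bump_prod_expansion G F HF M F) as (a & l & Ha & Hl & El); [apply incl_refl|].
  exists a, (q ^ M), l; split; [lra|split; auto].
  intros z (t & Ht & Hz). rewrite <- El.
  eapply Rle_trans; [apply (bump_prod_le G M F z t Ht)|].
  apply pow_incr. assert (b := COS_bound (2 * PI * z t)).
  assert (c := cos_far_from_int eps (z t) He Hz). unfold q; lra.
Qed.

(** * Density of periodic points *)

Lemma frac_part_int_diff u : is_int (u - frac_part u).
Proof. exists (Int_part u); unfold frac_part; ring. Qed.

(** Reduction modulo 1 changes [lap] by integers, and normality turns right invariance into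
    invariance under [shift]. *)
Lemma Fix_of_periodic_solution (G : Group) (f : ZG G) H y :
  finite_index_normal G H -> periodic_solution G f H y ->
  Fix G f H (fun t => frac_part (y t)).
Proof.
  intros HH [Hy Ly]. split; [split|].
  - intros t. destruct (base_fp (y t)); split; lra.
  - intros t. change (is_int (lap G f (fun t => frac_part (y t)) t)).
    rewrite (lap_ext _ _ _ (fun q => y q - (y q - frac_part (y q)))) by (intros; ring).
    rewrite lap_minus. apply is_int_plus; auto. apply is_int_opp.
    apply lap_int_valued; intros; apply frac_part_int_diff.
  - intros s Hs. unfold Defs.shift. apply functional_extensionality; intros t. f_equal.
    apply (invariant_l G H HH); auto. apply (subgroup_inv G H HH); auto.
Qed.

Lemma tdist_lt_of_near_int a b k eps :
  0 <= a < 1 -> 0 <= b < 1 -> Rabs (a - b - IZR k) < eps -> tdist a b < eps.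
Proof.
  intros Ha Hb K. unfold tdist.
  destruct (Z.eq_dec k 0) as [->|N].
  - rewrite Rminus_0_r in K. eapply Rle_lt_trans; [apply Rmin_l|auto].
  - eapply Rle_lt_trans; [apply Rmin_r|].
    assert (1 <= Rabs (IZR k)) by (rewrite <- abs_IZR; apply IZR_le; lia).
    assert (T := Rabs_triang_inv (IZR k) (a - b)).
    rewrite Rabs_minus_sym in K. lra.
Qed.

Lemma periodic_points_dense (G : Group) (f : ZG G) (Gamma_n : nat -> G -> Prop)
    (Hf : well_balanced G f) (Hsub : forall n, finite_index_normal G (Gamma_n n))
    (Hlim : forall g : G, (forall n, exists i, (n <= i)%nat /\ Gamma_n i g) -> g = gone)
    (F : list G) (eps : R) :
  0 < eps ->
  exists N, forall n, (N <= n)%nat -> forall x, Xf G f x ->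
    exists y, Fix G f (Gamma_n n) y /\ forall t, In t F -> tdist (x t) (y t) < eps.
Proof.
  intros He.
  set (F' := nodup eq_dec F). assert (HF : NoDup F') by apply NoDup_nodup.
  set (e := Rmin eps (/ 4)).
  assert (He' : 0 < e <= / 4) by (split; [apply Rmin_glb_lt; lra|apply Rmin_r]).
  destruct (concentrated_kernel G F' e HF He') as (a & m & l & Ham & Hl & Kl).
  (* A nontrivial element lies in only finitely many of the subgroups, and a ball is finite. *)
  assert (avoid : forall K, exists N, forall n, (N <= n)%nat ->
            forall g, ball G f K g -> Gamma_n n g -> g = gone).
  { intros K. destruct (ball_finite G f K) as [L HL].
    assert (A : exists N, forall n, (N <= n)%nat -> forall g, In g L -> Gamma_n n g -> g = gone).
    { clear HL; induction L as [|g L [N IH]]; [exists 0%nat; simpl; tauto|].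
      destruct (eq_dec g gone) as [->|Hg].
      - exists N; intros n Hn g [<-|Hg] Hgn; eauto.
      - assert (B : exists N', forall n, (N' <= n)%nat -> ~ Gamma_n n g).
        { apply NNPP; intros Hno; apply Hg, Hlim; intros n.
          apply NNPP; intros Hn; apply Hno; exists n; intros i Hi Hgi; apply Hn; eauto. }
        destruct B as [N' HN']. exists (N + N')%nat. intros n Hn k [<-|Hk] Hkn.
        + exfalso; apply (HN' n); auto; lia.
        + apply (IH n); auto; lia. }
    destruct A as [N HN]. exists N; eauto. }
  (* The kernel is fixed before [n], so only finitely many frequencies, hence finitely many radii,
     are involved. *)
  assert (lifts : exists N, forall n, (N <= n)%nat -> forall c, In c l ->
            annihilates G F' (periodic_solution G f (Gamma_n n)) (snd c) ->
            forall x, (forall p, is_int (lap G f x p)) -> is_int (pairing G F' (snd c) x)).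
  { clear Hl Kl. induction l as [|c l [N IH]]; [exists 0%nat; simpl; tauto|].
    destruct (annihilator_descends_to_Xf G f Hf F' (snd c) HF) as [K HK].
    destruct (avoid K) as [N' HN']. exists (N + N')%nat. intros n Hn d [<-|Hd] A x Hx.
    - apply (HK (Gamma_n n)); auto. apply HN'; lia.
    - apply (IH n); auto; lia. }
  destruct lifts as [N HN]. exists N; intros n Hn x [Tx Lx].
  set (Y := periodic_solution G f (Gamma_n n)).
  (* Otherwise each point of [x + Y] has a coordinate in [F'] far from the integers, so the kernel
     is at most [m] on [x + Y], which forces [a <= m]. *)
  assert (near_int : exists y, Y y /\ forall t, In t F' -> exists k, Rabs (x t + y t - IZR k) < e).
  { apply NNPP; intros Hno. apply (Rlt_not_le _ _ Ham).
    apply (trig_positive_on_annihilator G F' Y a m x l); auto.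
    - intros y z k [Hy Ly] [Hz Lz]; split.
      + intros g h Hh; rewrite (Hy _ _ Hh), (Hz _ _ Hh); auto.
      + intros p; rewrite lap_plus, lap_scal. apply is_int_plus; auto. apply is_int_mult; auto.
        exists (Z.of_nat k); apply INR_IZR_INZ.
    - split; [intros ? ? ?; auto|]. intros p. apply lap_int_valued. exists 0%Z; auto.
    - intros c Hc A. exact (HN n Hn c Hc A x Lx).
    - intros y Hy. apply Kl. apply NNPP; intros Hn'. apply Hno. exists y; split; auto.
      intros t Ht. apply NNPP; intros Hk. apply Hn'. exists t; split; auto.
      intros k. apply Rnot_lt_le; intros Hlt; apply Hk; eauto. }
  destruct near_int as (y & [Hy Ly] & Ny).
  exists (fun t => frac_part (- y t)). split.
  - apply (Fix_of_periodic_solution G f _ (fun t => - y t)); auto. split.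
    + intros g h Hh; rewrite (Hy _ _ Hh); auto.
    + intros p; rewrite lap_opp; apply is_int_opp; auto.
  - intros t Ht. destruct (Ny t) as [k Hk]; [apply nodup_In; auto|].
    apply tdist_lt_of_near_int with (k := (k + Int_part (- y t))%Z); auto.
    + destruct (base_fp (- y t)); lra.
    + rewrite plus_IZR. unfold frac_part.
      replace (x t - (- y t - IZR (Int_part (- y t))) - (IZR k + IZR (Int_part (- y t))))
        with (x t + y t - IZR k) by ring.
      eapply Rlt_le_trans; [exact Hk|apply Rmin_l].
Qed.

(** * Compactness of [X_f] *)

Definition clusters (x : nat -> nat -> R) (j : nat) (L : nat -> R) : Prop :=
  forall eps K, 0 < eps ->
    exists k, (K <= k)%nat /\ forall i, (i < j)%nat -> Rabs (x k i - L i) < eps.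

(** The new coordinate is an upper limit of [x k j], taken along indices at which the first [j]
    coordinates approach [L]; no subsequence is extracted. *)
Lemma clusters_step x j L :
  (forall k i, 0 <= x k i <= 1) -> clusters x j L ->
  exists r, 0 <= r <= 1 /\ clusters x (S j) (fun i => if Nat.eq_dec i j then r else L i).
Proof.
  intros Hx HL.
  set (E := fun r => forall eps K, 0 < eps ->
    exists k, (K <= k)%nat /\ (forall i, (i < j)%nat -> Rabs (x k i - L i) < eps) /\ r <= x k j).
  assert (E0 : E 0).
  { intros eps K He. destruct (HL eps K He) as [k [Hk Hi]]. exists k; repeat split; auto. apply Hx. }
  assert (E1 : forall r, E r -> r <= 1).
  { intros r Hr. destruct (Hr 1 0%nat) as (k & _ & _ & H); [lra|]. destruct (Hx k j); lra. }
  destruct (completeness E) as [r [Ub Lub]]; [exists 1; exact E1|exists 0; auto|].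
  exists r; split; [split; [apply Ub; auto|apply Lub; exact E1]|].
  intros eps K He.
  assert (Hlo : exists r', E r' /\ r - eps < r').
  { apply NNPP; intros N. assert (r <= r - eps); [|lra]. apply Lub; intros r' Hr'.
    apply Rnot_lt_le; intros Hlt; apply N; eauto. }
  destruct Hlo as (r' & Er' & Hr').
  assert (Hhi : exists e0 K0, 0 < e0 /\ forall k, (K0 <= k)%nat ->
            (forall i, (i < j)%nat -> Rabs (x k i - L i) < e0) -> x k j < r + eps).
  { apply NNPP; intros N. assert (Ee : E (r + eps)).
    { intros e0 K0 He0. apply NNPP; intros M. apply N. exists e0, K0; split; auto.
      intros k Hk Hi. apply Rnot_le_lt; intros Hle; apply M; eauto. }
    apply Ub in Ee; lra. }
  destruct Hhi as (e0 & K0 & He0 & Hhi).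
  destruct (Er' (Rmin eps e0) (K + K0)%nat) as (k & Hk & Hi & Hkj); [apply Rmin_glb_lt; auto|].
  exists k; split; [lia|]. intros i Hij. destruct (Nat.eq_dec i j) as [->|N].
  - assert (x k j < r + eps).
    { apply Hhi; [lia|]. intros i Hi'. eapply Rlt_le_trans; [apply Hi; auto|apply Rmin_r]. }
    apply Rabs_def1; lra.
  - eapply Rlt_le_trans; [apply Hi; lia|apply Rmin_l].
Qed.

Fixpoint cluster_prefix (x : nat -> nat -> R) (j : nat) : nat -> R :=
  match j with
  | O => fun _ => 0
  | S j => fun i => if Nat.eq_dec i j
      then epsilon (inhabits 0) (fun r => 0 <= r <= 1 /\
             clusters x (S j) (fun i => if Nat.eq_dec i j then r else cluster_prefix x j i))
      else cluster_prefix x j i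
  end.

Lemma cluster_exists x :
  (forall k i, 0 <= x k i <= 1) ->
  exists L, (forall i, 0 <= L i <= 1) /\ forall j, clusters x j L.
Proof.
  intros Hx.
  assert (step : forall j, clusters x j (cluster_prefix x j) ->
     0 <= cluster_prefix x (S j) j <= 1 /\ clusters x (S j) (cluster_prefix x (S j))).
  { intros j Hj. destruct (epsilon_spec (inhabits 0) _ (clusters_step x j _ Hx Hj)) as [H1 H2].
    simpl cluster_prefix. split; [|exact H2]. destruct (Nat.eq_dec j j); [exact H1|tauto]. }
  assert (all : forall j, clusters x j (cluster_prefix x j)).
  { induction j; [|apply step; auto].
    intros eps K He. exists K; split; auto. intros; lia. }
  exists (fun i => cluster_prefix x (S i) i). split; [intros i; apply step; auto|].
  assert (agree : forall j i, (i < j)%nat -> cluster_prefix x j i = cluster_prefix x (S i) i).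
  { induction j as [|j IH]; intros i Hi; [lia|].
    destruct (Nat.eq_dec i j) as [->|N]; auto.
    rewrite <- IH by lia. simpl. destruct (Nat.eq_dec i j); tauto. }
  intros j eps K He. destruct (all j eps K He) as [k [Hk Hi]]. exists k; split; auto.
  intros i Hij. rewrite <- (agree j i Hij); auto.
Qed.

Lemma is_int_of_approx a :
  (forall eps, 0 < eps -> exists b, is_int b /\ Rabs (a - b) < eps) -> is_int a.
Proof.
  intros A. destruct (base_fp a) as [w0 w1].
  assert (Ew : a = frac_part a + IZR (Int_part a)) by (unfold frac_part; ring).
  destruct (Req_dec (frac_part a) 0) as [E|E]; [exists (Int_part a); lra|exfalso].
  set (w := frac_part a) in *. clearbody w. revert Ew; generalize (Int_part a); intros i Ew.
  destruct (A (Rmin w (1 - w))) as (b & [k ->] & Hb); [apply Rmin_glb_lt; lra|].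
  assert (B1 := Rmin_l w (1 - w)). assert (B2 := Rmin_r w (1 - w)).
  apply Rabs_def2 in Hb.
  assert (L1 : (i < k)%Z) by (apply lt_IZR; lra).
  assert (L2 : (k < i + 1)%Z) by (apply lt_IZR; rewrite plus_IZR; lra).
  lia.
Qed.

Lemma lap_close (G : Group) (f : ZG G) u v t eps :
  (forall s, In s (supp f) -> Rabs (u (gmul t s) - v (gmul t s)) <= eps) ->
  Rabs (lap G f u t - lap G f v t) <= eps * rsum (supp f) (fun s => Rabs (IZR (coef f s))).
Proof.
  intros H. rewrite <- lap_minus. unfold lap. eapply Rle_trans; [apply rsum_Rabs|].
  rewrite <- rsum_scal. apply rsum_le; intros s Hs. rewrite Rabs_mult.
  apply Rmult_le_compat_r; [apply Rabs_pos|auto].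
Qed.

(** Sequential compactness of [Xf]: a coordinatewise cluster point, with integrality of [lap]
    passing to the limit because the integers are closed. *)
Lemma Xf_cluster (G : Group) (f : ZG G) (idx : G -> nat) (enum : nat -> G) (u : nat -> G -> R) :
  (forall g, enum (idx g) = g) -> (forall k, Xf G f (u k)) ->
  exists x, Xf G f x /\ forall F eps K, 0 < eps ->
    exists k, (K <= k)%nat /\ forall t, In t F -> tdist (u k t) (x t) < eps.
Proof.
  intros Henum Hu.
  destruct (cluster_exists (fun k i => u k (enum i))) as (L & HL & CL).
  { intros k i. destruct (Hu k) as [T _]. destruct (T (enum i)); lra. }
  set (l := fun g => L (idx g)).
  assert (Cl : forall F eps K, 0 < eps ->
    exists k, (K <= k)%nat /\ forall t, In t F -> Rabs (u k t - l t) < eps).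
  { intros F eps K He. destruct (CL (S (list_max (map idx F))) eps K He) as [k [Hk Hi]].
    exists k; split; auto. intros t Ht. rewrite <- (Henum t) at 1. apply Hi.
    apply Nat.lt_succ_r. assert (M := proj1 (list_max_le (map idx F) _) (le_n _)).
    rewrite Forall_forall in M. apply M, in_map; auto. }
  (* A limit of representatives in [[0,1)] can equal 1; it is replaced by 0, the same point of the
     circle. *)
  set (x := fun g => if Req_dec_T (l g) 1 then 0 else l g).
  assert (Hxl : forall g, is_int (l g - x g)).
  { intros g; unfold x; destruct (Req_dec_T (l g) 1) as [E|E].
    - exists 1%Z; lra.
    - exists 0%Z; lra. }
  exists x; split; [split|].
  - intros t; unfold x, l. assert (b := HL (idx t)).
    destruct (Req_dec_T (L (idx t)) 1); lra.
  - intros t. change (is_int (lap G f x t)).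
    rewrite (lap_ext _ _ _ (fun q => l q - (l q - x q))) by (intros; ring).
    rewrite lap_minus. apply is_int_plus; [|apply is_int_opp, lap_int_valued; auto].
    apply is_int_of_approx; intros eps He.
    set (C := rsum (supp f) (fun s => Rabs (IZR (coef f s)))).
    assert (HC : 0 <= C).
    { unfold C. rewrite <- (rsum_zero (supp f) (fun _ => 0)) by auto.
      apply rsum_le; intros; apply Rabs_pos. }
    destruct (Cl (map (gmul t) (supp f)) (eps / (C + 1)) 0%nat) as [k [_ Hk]].
    { apply Rdiv_lt_0_compat; lra. }
    exists (lap G f (u k) t); split; [apply (Hu k)|].
    rewrite Rabs_minus_sym.
    eapply Rle_lt_trans; [apply (lap_close G f _ _ _ (eps / (C + 1)))|].
    + intros s Hs. left; apply Hk, in_map; auto.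
    + fold C. apply Rmult_lt_reg_r with (C + 1); [lra|].
      replace (eps / (C + 1) * C * (C + 1)) with (eps * C) by (field; lra). nra.
  - intros F eps K He. destruct (Cl F eps K He) as [k [Hk Ht]].
    exists k; split; auto. intros t HtF. specialize (Ht t HtF).
    destruct (Hu k) as [T _]. specialize (T t). assert (b := HL (idx t)). fold (l t) in b.
    unfold x. destruct (Req_dec_T (l t) 1) as [E|E].
    + apply tdist_lt_of_near_int with 1%Z; [lra|lra|]. rewrite E in Ht. rewrite Rminus_0_r; auto.
    + apply tdist_lt_of_near_int with 0%Z; [lra|lra|]. rewrite Rminus_0_r; auto.
Qed.

Lemma tdist_sym a b : tdist a b = tdist b a.
Proof. unfold tdist; rewrite Rabs_minus_sym; auto. Qed.

Lemma tdist_triangle a b c :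
  0 <= a < 1 -> 0 <= b < 1 -> 0 <= c < 1 -> tdist a c <= tdist a b + tdist b c.
Proof.
  intros Ha Hb Hc. unfold tdist, Rmin.
  repeat match goal with |- context [Rle_dec ?u ?v] => destruct (Rle_dec u v) end;
  unfold Rabs in *; repeat destruct Rcase_abs; lra.
Qed.

Lemma group_enumeration (G : Group) (f : ZG G) :
  well_balanced G f -> exists (idx : G -> nat) (enum : nat -> G), forall g, enum (idx g) = g.
Proof.
  intros Hf.
  set (L := fun k => proj1_sig (constructive_indefinite_description _ (ball_finite G f k))).
  assert (HL : forall k g, ball G f k g -> In g (L k))
    by (intros k; exact (proj2_sig (constructive_indefinite_description _ (ball_finite G f k)))).
  set (enum := fun n => nth (snd (Cantor.of_nat n)) (L (fst (Cantor.of_nat n))) gone).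
  assert (K : forall g, exists n, enum n = g).
  { intros g. destruct (ball_exhaust G f Hf g) as [k Hk].
    destruct (In_nth _ _ gone (HL k g Hk)) as (i & _ & Hi).
    exists (Cantor.to_nat (k, i)). unfold enum. rewrite Cantor.cancel_of_to. auto. }
  exists (fun g => proj1_sig (constructive_indefinite_description _ (K g))), enum.
  intros g. exact (proj2_sig (constructive_indefinite_description _ (K g))).
Qed.

(** Uniform continuity by compactness: pairs violating it on growing windows would cluster at one
    point [x], and the [rho]-ball of radius [delta / 2] about [x], open in the product topology,
    would contain both members of such a pair. *)
Lemma compatible_metric_uniform (G : Group) (f : ZG G) rho delta :
  well_balanced G f -> compatible_metric G f rho -> 0 < delta ->
  exists F eps, 0 < eps /\ forall x y, Xf G f x -> Xf G f y ->
    (forall t, In t F -> tdist (x t) (y t) < eps) -> rho x y < delta.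
Proof.
  intros Hf [Hm Hop] Hd. destruct (group_enumeration G f Hf) as (idx & enum & Henum).
  apply NNPP; intros Hno.
  set (F := fun k => map enum (seq 0 k)).
  assert (bad : forall k, exists p : (G -> R) * (G -> R), Xf G f (fst p) /\ Xf G f (snd p) /\
     (forall t, In t (F k) -> tdist (fst p t) (snd p t) < / INR (S k)) /\ delta <= rho (fst p) (snd p)).
  { intros k. apply NNPP; intros N. apply Hno. exists (F k), (/ INR (S k)). split.
    - apply Rinv_0_lt_compat, lt_0_INR; lia.
    - intros x y Hx Hy Hxy. apply Rnot_le_lt; intros Hle. apply N. exists (x, y); auto. }
  set (p := fun k => proj1_sig (constructive_indefinite_description _ (bad k))).
  assert (Hp := fun k => proj2_sig (constructive_indefinite_description _ (bad k))).
  fold p in Hp. change (forall k, Xf G f (fst (p k)) /\ Xf G f (snd (p k)) /\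
     (forall t, In t (F k) -> tdist (fst (p k) t) (snd (p k) t) < / INR (S k)) /\
     delta <= rho (fst (p k)) (snd (p k))) in Hp.
  destruct (Xf_cluster G f idx enum (fun k => fst (p k)) Henum) as (x & Hx & Cx).
  { intros k; apply Hp. }
  set (U := fun y => Xf G f y /\ rho x y < delta / 2).
  assert (HU : product_open G f U).
  { apply Hop. split; [intros y Hy; apply Hy|]. intros y [Hy Hxy].
    exists (delta / 2 - rho x y). split; [lra|]. intros z Hz Hyz. split; auto.
    destruct (Hm x y z) as (_ & _ & _ & T); auto. lra. }
  destruct HU as [_ HU]. destruct (HU x) as (F0 & eps & He & Hball).
  { split; auto. destruct (Hm x x x) as (_ & E & _); auto. rewrite (proj2 E); auto; lra. }
  destruct (INR_unbounded (/ (eps / 2))) as [K0 HK0].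
  (* The index is taken large enough that [/ INR (S k) < eps / 2] and that the window [F k] contains
     [F0]. *)
  destruct (Cx F0 (eps / 2) (K0 + S (list_max (map idx F0)))%nat) as (k & Hk & Hclose); [lra|].
  destruct (Hp k) as (Hu & Hv & Huv & Hrho).
  assert (Ik : / INR (S k) < eps / 2).
  { rewrite <- (Rinv_inv (eps / 2)). apply Rinv_lt_contravar.
    - apply Rmult_lt_0_compat; [apply Rinv_0_lt_compat; lra|apply lt_0_INR; lia].
    - eapply Rlt_le_trans; [exact HK0|]. apply le_INR; lia. }
  assert (Fk : forall t, In t F0 -> In t (F k)).
  { intros t Ht. unfold F. rewrite <- (Henum t). apply in_map, in_seq.
    assert (M := proj1 (list_max_le (map idx F0) _) (le_n _)).
    rewrite Forall_forall in M. specialize (M (idx t) (in_map idx _ _ Ht)). lia. }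
  assert (U1 : U (fst (p k))).
  { apply Hball; auto. intros t Ht. rewrite tdist_sym. specialize (Hclose t Ht); simpl in *; lra. }
  assert (U2 : U (snd (p k))).
  { apply Hball; auto. intros t Ht. specialize (Hclose t Ht). specialize (Huv t (Fk t Ht)).
    rewrite tdist_sym in Hclose.
    assert (T := tdist_triangle (x t) (fst (p k) t) (snd (p k) t)
      (proj1 Hx t) (proj1 Hu t) (proj1 Hv t)). simpl in *; lra. }
  destruct U1 as [_ U1], U2 as [_ U2].
  destruct (Hm (fst (p k)) x (snd (p k))) as (_ & _ & S1 & T); auto. lra.
Qed.

(** * Hausdorff convergence *)

(** Completeness supplies a least upper bound, so [epsilon] returns a genuine one and not a default
    value. *)
Lemma Rsup_bounds (E : R -> Prop) d :
  (exists r, E r) -> (forall r, E r -> 0 <= r <= d) -> 0 <= Rsup E <= d.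
Proof.
  intros [r0 H0] B.
  destruct (completeness E) as [s Hs]; [exists d; intros r Hr; apply B; auto|eauto|].
  destruct (epsilon_spec (inhabits 0) (is_lub E) (ex_intro _ s Hs)) as [Ub Lub].
  fold (Rsup E) in Ub, Lub. split.
  - apply Rle_trans with r0; [apply B|apply Ub]; auto.
  - apply Lub; intros r Hr; apply B; auto.
Qed.

Lemma Rinf_bounds (E : R -> Prop) d :
  (forall r, E r -> 0 <= r) -> E d -> 0 <= Rinf E <= d.
Proof.
  intros B Hd. unfold Rinf.
  destruct (completeness (fun r => E (- r))) as [s Hs].
  - exists 0; intros r Hr; apply B in Hr; lra.
  - exists (- d); rewrite Ropp_involutive; auto.
  - destruct (epsilon_spec (inhabits 0) _ (ex_intro _ s Hs)) as [Ub Lub].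
    fold (Rsup (fun r => E (- r))) in Ub, Lub. split.
    + assert (Rsup (fun r => E (- r)) <= 0); [|lra].
      apply Lub; intros r Hr; apply B in Hr; lra.
    + assert (- d <= Rsup (fun r => E (- r))); [|lra].
      apply Ub; rewrite Ropp_involutive; auto.
Qed.

Theorem theorem5p1 (G : Group) (Gamma_n : nat -> G -> Prop) (f : ZG G)
    (rho : (G -> R) -> (G -> R) -> R)
    (Hfg : finitely_generated G) (Hrf : residually_finite G) (Hinf : infinite_group G)
    (Hsub : forall n, finite_index_normal G (Gamma_n n))
    (Hlim : forall g : G, (forall n, exists i, (n <= i)%nat /\ Gamma_n i g) -> g = gone)
    (Hf : well_balanced G f)
    (Hrho : compatible_metric G f rho) :
  Un_cv (fun n => hausdorff_dist rho (Fix G f (Gamma_n n)) (Xf G f)) 0.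
Proof.
  intros delta Hd.
  (* Halving [delta] leaves room for a supremum, which only inherits non-strict bounds. *)
  destruct (compatible_metric_uniform G f rho (delta / 2) Hf Hrho) as (F & eps & He & Hunif);
    [lra|].
  destruct (periodic_points_dense G f Gamma_n Hf Hsub Hlim F eps He) as [N HN].
  exists N; intros n Hn. specialize (HN n Hn). destruct Hrho as [Hm _].
  assert (pos : forall x y, Xf G f x -> Xf G f y -> 0 <= rho x y)
    by (intros x y Hx Hy; apply (Hm x y x); auto).
  assert (Fix0 : Fix G f (Gamma_n n) (fun _ => frac_part 0)).
  { apply (Fix_of_periodic_solution G f _ (fun _ => 0)); auto.
    split; [intros ? ? ?; auto|]. intros p; apply lap_int_valued; exists 0%Z; auto. }
  (* Every periodic point already lies in [Xf], so this one-sided distance is zero. *)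
  assert (B1 : 0 <= Rsup (fun r => exists y, Fix G f (Gamma_n n) y /\
             r = Rinf (fun d => exists z, Xf G f z /\ d = rho y z)) <= 0).
  { apply Rsup_bounds; [do 2 eexists; split; [exact Fix0|reflexivity]|].
    intros r (y & [Hy _] & ->). apply Rinf_bounds.
    - intros d (z & Hz & ->); auto.
    - exists y; split; auto. destruct (Hm y y y) as (_ & E & _); auto. symmetry; apply E; auto. }
  assert (B2 : 0 <= Rsup (fun r => exists z, Xf G f z /\
             r = Rinf (fun d => exists y, Fix G f (Gamma_n n) y /\ d = rho z y)) <= delta / 2).
  { apply Rsup_bounds; [do 2 eexists; split; [exact (proj1 Fix0)|reflexivity]|].
    intros r (z & Hz & ->). destruct (HN z Hz) as (y & Hy & Hzy).
    assert (L : rho z y < delta / 2) by (apply Hunif; auto; apply Hy).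
    assert (I : 0 <= Rinf (fun d => exists y, Fix G f (Gamma_n n) y /\ d = rho z y) <= rho z y).
    { apply Rinf_bounds; [|eauto]. intros d (w & [Hw _] & ->); auto. }
    lra. }
  unfold Rdist, hausdorff_dist. rewrite Rminus_0_r, Rabs_right.
  - apply Rmax_lub_lt; lra.
  - apply Rle_ge. eapply Rle_trans; [|apply Rmax_l]. apply B1.
Qed.
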